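(* Let $N\geq 2$, $p>1$, let $\Omega\subset\mathbb{R}^N$ be a bounded and smooth domain, and let $u$ be the weak solution of $$-\Delta_p w=\frac{\mu(\Omega)}{|\Omega|}w^{-1}\ \text{in }\Omega,\qquad w>0\ \text{in }\Omega,\qquad w=0\ \text{on }\partial\Omega.$$ For each $\lambda>0$, the function $$u_\lambda:=\left(\frac{\lambda|\Omega|}{\mu(\Omega)}\right)^{1/p}u$$ is the unique weak solution of the singular problem $$-\Delta_p v=\lambda v^{-1}\ \text{in }\Omega,\qquad v>0\ \text{in }\Omega,\qquad v=0\ \text{on }\partial\Omega,$$ and $$\int_\Omega\log u_\lambda\,dx=\frac{|\Omega|}{p}\log\left(\frac{\lambda|\Omega|}{\mu(\Omega)}\right).$$
   Context: $|\Omega|$ denotes the $N$-dimensional Lebesgue measure of $\Omega$, $\|\cdot\|_p$ the norm of $L^p(\Omega)$, and $\Delta_p v=\operatorname{div}(|\nabla v|^{p-2}\nabla v)$. For $q\in(0,1)$, $$\lambda_q(\Omega):=\inf\left\{\|\nabla v\|_p^p : v\in W_0^{1,p}(\Omega)\ \text{and}\ \int_\Omega |v|^q\,dx=1\right\},\qquad \mu(\Omega):=\lim_{q\to0^+}\lambda_q(\Omega)|\Omega|^{p/q}\in(0,\infty).$$ For $\lambda>0$, a weak solution of $-\Delta_p v=\lambda v^{-1}$ in $\Omega$, $v>0$ in $\Omega$, $v=0$ on $\partial\Omega$, is a function $v\in W_0^{1,p}(\Omega)$ with $\operatorname{ess\,inf}_K v>0$ for each compact $K\subset\Omega$ and $\int_\Omega|\nabla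 v|^{p-2}\nabla v\cdot\nabla\varphi\,dx=\lambda\int_\Omega v^{-1}\varphi\,dx$ for all $\varphi\in W_0^{1,p}(\Omega)$. For $\lambda=\mu(\Omega)/|\Omega|$ such a solution exists and is unique; it is the function $u$. *)

(* Defs.v *)
From HB Require Import structures.
From mathcomp Require Import all_boot all_order all_algebra.
From mathcomp Require Import all_classical all_reals all_analysis.
From mathcomp Require Import ess_sup_inf.

Set Implicit Arguments.
Unset Strict Implicit.
Unset Printing Implicit Defensive.

Import Order.TTheory GRing.Theory Num.Theory.
Import numFieldNormedType.Exports.

Local Open Scope classical_set_scope.
Local Open Scope ring_scope.

(* R^n is 'rV[R]_n.  The norm the library puts on it is the sup norm; it is
   only used for its topology and for boundedness, the Euclidean length of
   vectors being [enorm] below. *)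

Definition rV_display : measure_display.
Proof. exact: default_measure_display. Qed.

(* The sigma-algebra generated by the coordinates, i.e. the Borel one, in line
   with the measurable structure of the library on R and on n.-tuple R.  Every
   Lebesgue measurable function is a.e. equal to a Borel measurable one. *)
Section measurable_rV.
Variables (R : realType) (n : nat).

Definition rV_coord (i : 'I_n) (x : 'rV[R]_n) : R := x ord0 i.

Let rV_set0 : g_sigma_preimage rV_coord set0.
Proof. exact: sigma_algebra0. Qed.

Let rV_setC A : g_sigma_preimage rV_coord A -> g_sigma_preimage rV_coord (~` A).
Proof. exact: sigma_algebraC. Qed.

Let rV_bigcup (F : _^nat) : (forall i, g_sigma_preimage rV_coord (F i)) ->
  g_sigma_preimage rV_coord (\bigcup_i (F i)).
Proof. exact: sigma_algebra_bigcup. Qed.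

HB.instance Definition _ := @isMeasurable.Build rV_display
  'rV[R]_n (g_sigma_preimage rV_coord) rV_set0 rV_setC rV_bigcup.

Lemma measurable_rV_coord (i : 'I_n) :
  measurable_fun [set: 'rV[R]_n] (rV_coord i).
Proof.
move=> _ Y mY; rewrite setTI; apply: sub_sigma_algebra => /=.
rewrite -bigcup_seq/=; exists i => /=; first by rewrite mem_index_enum.
by exists Y => //; rewrite setTI.
Qed.

Lemma measurable_fun_rVP d (T : measurableType d) (f : T -> 'rV[R]_n) :
  (forall i, measurable_fun [set: T] (rV_coord i \o f)) ->
  measurable_fun [set: T] f.
Proof.
move=> mf.
suff prefS : g_sigma_preimage (fun i => rV_coord i \o f) `<=` measurable.
  move=> _ A mA; apply: prefS; rewrite g_sigma_preimage_comp.
  by exists A.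
apply: smallest_sub; first exact: sigma_algebra_measurable.
rewrite -bigcup_seq => A [i _ [B mB <-]]; exact: mf.
Qed.

End measurable_rV.

Section lebesgue_rV.
Variable R : realType.

Definition rV_cons n (z : R * 'rV[R]_n) : 'rV[R]_n.+1 :=
  \row_i oapp (z.2 ord0) z.1 (unlift ord0 i).

Definition rV_uncons n (x : 'rV[R]_n.+1) : R * 'rV[R]_n :=
  (x ord0 ord0, \row_i x ord0 (lift ord0 i)).

Lemma rV_cons_ord0 n z : @rV_cons n z ord0 ord0 = z.1.
Proof. by rewrite mxE unlift_none. Qed.

Lemma rV_cons_lift n z i : @rV_cons n z ord0 (lift ord0 i) = z.2 ord0 i.
Proof. by rewrite mxE liftK. Qed.

Lemma rV_consK n : cancel (@rV_cons n) (@rV_uncons n).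
Proof.
move=> [a y]; rewrite /rV_uncons rV_cons_ord0; congr pair.
by apply/rowP => i; rewrite mxE rV_cons_lift.
Qed.

Lemma measurable_rV_cons n : measurable_fun [set: R * 'rV[R]_n] (@rV_cons n).
Proof.
apply: measurable_fun_rVP => i.
have [j ->|->] := unliftP ord0 i.
- rewrite (_ : _ \o _ = rV_coord j \o snd).
    apply: measurableT_comp => //; exact: measurable_rV_coord.
  by apply/funext => z /=; exact: rV_cons_lift.
- rewrite (_ : _ \o _ = fst) //.
  by apply/funext => z /=; exact: rV_cons_ord0.
Qed.

Lemma measurable_rV_uncons n :
  measurable_fun [set: 'rV[R]_n.+1] (@rV_uncons n).
Proof.
apply/measurable_fun_pairP; split; first exact: measurable_rV_coord.
apply: measurable_fun_rVP => i.
rewrite (_ : _ \o _ = rV_coord (lift ord0 i)); first exact: measurable_rV_coord.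
by apply/funext => x /=; rewrite /rV_coord mxE.
Qed.

(* Lebesgue measure on R^n.+1 is the product of that of R and that of R^n, seen
   through the bijection R * R^n -> R^n.+1; on R^0 it is the unit mass. *)
Section step.
Variables (n : nat) (m : {sigma_finite_measure set 'rV[R]_n -> \bar R}).

Definition lebesgue_rV_step : set 'rV[R]_n.+1 -> \bar R :=
  pushforward (@lebesgue_measure R \x m)%E (@rV_cons n).

Let step_preimage A : measurable A -> measurable (@rV_cons n @^-1` A).
Proof.
by move=> mA; rewrite -[X in measurable X]setTI; exact: measurable_rV_cons.
Qed.

Let step0 : lebesgue_rV_step set0 = 0%E.
Proof. by rewrite /lebesgue_rV_step /pushforward preimage_set0 measure0. Qed.

Let step_ge0 A : (0 <= lebesgue_rV_step A)%E.
Proof. by rewrite /lebesgue_rV_step /pushforward measure_ge0. Qed.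

Let step_sigma_additive : semi_sigma_additive lebesgue_rV_step.
Proof.
move=> F mF tF mUF; rewrite /lebesgue_rV_step /pushforward preimage_bigcup.
apply: measure_semi_sigma_additive.
- by move=> k; exact: step_preimage.
- apply/trivIsetP => /= i j _ _ ij; rewrite -preimage_setI.
  by move/trivIsetP : tF => /(_ _ _ _ _ ij) ->//; rewrite preimage_set0.
- by rewrite -preimage_bigcup; exact: step_preimage.
Qed.

HB.instance Definition _ := isMeasure.Build _ _ _ lebesgue_rV_step
  step0 step_ge0 step_sigma_additive.

Let step_sigma_finite : sigma_finite setT lebesgue_rV_step.
Proof.
have /sigma_finiteP[F [FT ndF Foo]] := sigma_finiteT (@lebesgue_measure R).
have /sigma_finiteP[G [GT ndG Goo]] := sigma_finiteT m.
exists (fun k => @rV_uncons n @^-1` (F k `*` G k)).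
  rewrite -preimage_bigcup (_ : \bigcup_k _ = setT) ?preimage_setT//.
  rewrite -setXTT FT GT predeqE => -[x y]; split.
    by move=> [k _ []/= ? ?]; split; exists k.
  move=> [/= [k _ Fkx] [l _ Gly]]; exists (maxn k l) => //; split.
  - by move: x Fkx; exact/subsetPset/ndF/leq_maxl.
  - by move: y Gly; exact/subsetPset/ndG/leq_maxr.
move=> k; have [mF Fk] := Foo k; have [mG Gk] := Goo k; split.
  rewrite -[X in measurable X]setTI; apply: measurable_rV_uncons => //.
  exact: measurableX.
rewrite /lebesgue_rV_step /pushforward (_ : _ @^-1` _ = F k `*` G k).
  by rewrite product_measure1E// lte_mul_pinfty// ge0_fin_numE.
by apply/funext => z; rewrite -[in RHS](rV_consK z).
Qed.

HB.instance Definition _ := Measure_isSigmaFinite.Build _ _ _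
  lebesgue_rV_step step_sigma_finite.

End step.

Fixpoint lebesgue_rV n : {sigma_finite_measure set 'rV[R]_n -> \bar R} :=
  if n is k.+1 then lebesgue_rV_step (lebesgue_rV k)
  else @dirac _ 'rV[R]_0 0 R.

End lebesgue_rV.

Section euclidean.
Variables (R : realType) (n : nat).
Implicit Types x y : 'rV[R]_n.

Definition dotrv x y : R := \sum_(i < n) x ord0 i * y ord0 i.

Definition enorm x : R := Num.sqrt (dotrv x x).

Definition partial (i : 'I_n) (f : 'rV[R]_n -> R) : 'rV[R]_n -> R :=
  'D_(delta_mx ord0 i) f.

Definition grad (f : 'rV[R]_n -> R) (x : 'rV[R]_n) : 'rV[R]_n :=
  \row_i partial i f x.

Fixpoint class_C (k : nat) (f : 'rV[R]_n -> R) : Prop :=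
  if k is k'.+1 then
    (forall x, differentiable f x) /\ forall i, class_C k' (partial i f)
  else continuous f.

Definition smooth (f : 'rV[R]_n -> R) : Prop := forall k, class_C k f.

End euclidean.

Section domains.
Variables (R : realType) (n : nat).

Definition is_domain (Omega : set 'rV[R]_n) : Prop :=
  [/\ open Omega, connected Omega & Omega !=set0].

(* Near each of its boundary points Omega is the region lying on one side of
   the graph of a smooth function giving one of the coordinates in terms of the
   n - 1 others ([col' i x] is x without its i-th coordinate). *)
Definition smooth_boundary (Omega : set 'rV[R]_n) : Prop :=
  forall x0, (closure Omega `&` closure (~` Omega)) x0 ->
  exists (i : 'I_n) (s : bool) (gamma : 'rV[R]_n.-1 -> R),
    smooth gamma /\
    \forall x \near x0, Omega x <-> gamma (col' i x) < (-1) ^+ s * x ord0 i.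

Definition test_function (Omega : set 'rV[R]_n) (phi : 'rV[R]_n -> R) : Prop :=
  [/\ smooth phi, compact (closure [set x | phi x != 0])
    & closure [set x | phi x != 0] `<=` Omega].

End domains.

(* Functions on Omega are represented by functions on R^n, of which only the
   values on Omega matter. *)
Section sobolev.
Variables (R : realType) (n : nat).
Local Notation E := 'rV[R]_n.
Local Notation leb := (lebesgue_rV R n).
Variables (Omega : set E) (p : R).
Implicit Types (v w f : E -> R) (G : E -> E).

Definition norm_Lp f : \bar R := 'N[leb]_p%:E[EFin \o (f \_ Omega)].

Definition in_Lp f : Prop := measurable_fun Omega f /\ (norm_Lp f < +oo)%E.

Definition in_Lp_vec G : Prop :=
  measurable_fun Omega G /\ (norm_Lp (fun x => enorm (G x)) < +oo)%E.

Definition weak_gradient v G : Prop :=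
  forall phi, test_function Omega phi -> forall i,
  (\int[leb]_(x in Omega) (v x * partial i phi x)%:E =
   - \int[leb]_(x in Omega) (G x ord0 i * phi x)%:E)%E.

(* v belongs to W^{1,p}(Omega) and G represents its weak gradient, which is
   unique up to a.e. equality: below, quantifying over pairs (v, G) amounts to
   quantifying over v. *)
Definition W1p v G : Prop := [/\ in_Lp v, in_Lp_vec G & weak_gradient v G].

(* The closure of the test functions in W^{1,p}(Omega). *)
Definition W01p v G : Prop :=
  W1p v G /\
  forall e : R, 0 < e -> exists2 phi, test_function Omega phi &
    (norm_Lp (fun x => (v x - phi x)%R) +
     norm_Lp (fun x => enorm (G x - grad phi x)) < e%:E)%E.

Definition lambda_q (q : R) : \bar R :=
  ereal_inf [set y | exists v G, [/\ W01p v G,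
    (\int[leb]_(x in Omega) (`|v x| `^ q)%:E = 1)%E
    & y = (norm_Lp (fun x => enorm (G x)) `^ p)%E]].

Definition mu_Omega : \bar R :=
  lim ((lambda_q q * leb Omega `^ (p / q)%R)%E @[q --> 0^'+]).

Definition ess_inf_on (K : set E) v : \bar R :=
  ess_inf leb (patch (cst +oo%E) K (EFin \o v)).

(* The singular integral is required to converge absolutely.
   0 `^ (p - 2) is 1 if p = 2 and 0 otherwise, so the left-hand integrand is 0
   where the gradient of v vanishes, for every p. *)
Definition weak_solution (lambda : R) v : Prop :=
  exists2 G, W01p v G &
    (forall K, compact K -> K `<=` Omega -> (0 < ess_inf_on K v)%E) /\
    (forall phi Gphi, W01p phi Gphi ->
      leb.-integrable Omega (fun x => ((v x)^-1 * phi x)%:E) /\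
      (\int[leb]_(x in Omega)
         (enorm (G x) `^ (p - 2) * dotrv (G x) (Gphi x))%:E =
       lambda%:E * \int[leb]_(x in Omega) ((v x)^-1 * phi x)%:E)%E).

End sobolev.

(* Main.v *)
Require Import Defs.
From HB Require Import structures.
From mathcomp Require Import all_boot all_order all_algebra.
From mathcomp Require Import all_classical all_reals all_analysis.
From mathcomp Require Import measurable_realfun ess_sup_inf ring lra.

Set Implicit Arguments.
Unset Strict Implicit.
Unset Printing Implicit Defensive.

Import Order.TTheory GRing.Theory Num.Theory.
Import numFieldNormedType.Exports.

Local Open Scope classical_set_scope.
Local Open Scope ring_scope.

(** Write [V] for the volume of [Omega], [m] for the real part of [mu_Omega],
    [M_q v] for the power mean [(1/V int |v|^q)^(1/q)] and [M_0 v] for the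
    geometric mean [exp (1/V int ln |v|)].  Rescaling shows that [lambda_q * V ^ (p/q)] is the
    infimum of [|grad v|_p ^ p / (M_q v) ^ p], and everything comes from testing
    the equation of [u].

    Testing with [u] itself gives [|grad u|_p ^ p = m]
    ([solution_energy]); in particular the coefficient is nonnegative, and it
    is not [0], for otherwise [grad u = 0] and integration by parts against a
    coordinate gives [int u = 0] ([solution_lambda_gt0]).  So [m] is
    positive.

    Testing with [|v|] and using Hoelder's inequality gives
    [1/V int |v|/u <= |grad v|_p / |grad u|_p] ([solution_pairing_abs]).  Another
    use of Hoelder's inequality, [M_q v <= (1/V int |v|/u) * M_r u] with
    [r = q / (1 - q)], turns this into a lower bound for the infimum
    ([Lambda_ge]), while [u] is a competitor ([Lambda_le]):
    [m / (M_r u) ^ p <= lambda_q * V ^ (p/q) <= m / (M_q u) ^ p].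
    As [q] tends to [0] both means tend to [M_0 u] ([log_mean_cvg]), so the
    middle term, whose limit is [mu_Omega] by definition, tends to
    [m / (M_0 u) ^ p].  Were [M_0 u] zero, [mu_Omega] would be infinite and its
    real part [m] would be [0]; so [mu_Omega = m] and [M_0 u = 1], that is,
    [int ln u = 0].  The value of [int ln u_lambda] is then immediate.

    The operator is homogeneous of degree [p - 1] and the right-hand side of
    degree [- 1], so multiples of [u] solve the problems for the other values of
    [lambda] ([solvesZ]).  For uniqueness, two solutions [v], [w] for the same
    [lambda] have the same energy, so the pairing inequality gives
    [int w/v <= V] and [int v/w <= V]; as [w/v + v/w >= 2] with equality only if
    [v = w], they agree almost everywhere ([solves_uniq]).

    Testing with [|v|] is legitimate because [sqrt (phi^2 + e^2) - e] is a test
    function whenever [phi] is one, with a shorter gradient.  That test functions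
    belong to the Sobolev space at all is integration by parts in [R^n]
    ([integral_partial0]), by Fubini and the fundamental theorem of calculus. *)

(** * Borel sets and Lebesgue measure of [R^n] *)

Section rV_measure.
Variable R : realType.

Lemma coord_le_norm n (x : 'rV[R]_n) i : `|x ord0 i| <= `|x|.
Proof.
rewrite [leRHS]/Num.norm /= mx_normrE; apply/bigmax_geP; right => /=.
by exists (ord0, i).
Qed.

Lemma norm_rV_le n (x : 'rV[R]_n) M :
  0 <= M -> (forall i, `|x ord0 i| <= M) -> `|x| <= M.
Proof.
move=> M0 xM; rewrite [leLHS]/Num.norm /= mx_normrE; apply/bigmax_leP; split => //.
by move=> [i j] _ /=; rewrite ord1.
Qed.

Lemma norm_rV_lt n (x : 'rV[R]_n) M :
  0 < M -> (forall i, `|x ord0 i| < M) -> `|x| < M.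
Proof.
move=> M0 xM; rewrite [ltLHS]/Num.norm /= mx_normrE; apply/bigmax_ltP; split => //.
by move=> [i j] _ /=; rewrite ord1.
Qed.

Definition box n (c : 'rV[R]_n) (e : R) : set 'rV[R]_n :=
  [set x | forall i, `|x ord0 i - c ord0 i| <= e].

Definition obox n (c : 'rV[R]_n) (e : R) : set 'rV[R]_n :=
  [set x | forall i, `|x ord0 i - c ord0 i| < e].

Lemma measurable_coord_pre n (i : 'I_n) (B : set R) :
  measurable B -> measurable [set x : 'rV[R]_n | B (x ord0 i)].
Proof.
move=> mB; have := @measurable_rV_coord R n i measurableT B mB.
by rewrite setTI.
Qed.

Lemma measurable_box n (c : 'rV[R]_n) e : measurable (box c e).
Proof.
rewrite (_ : box c e =
  \bigcap_(i in [set: 'I_n]) [set x | `[c ord0 i - e, c ord0 i + e]%classic (x ord0 i)]).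
  apply: fin_bigcap_measurable; first exact: finite_finset.
  by move=> i _; apply: measurable_coord_pre.
apply/seteqP; split=> x /=.
  by move=> h i _ /=; rewrite in_itv/= -ler_distl.
by move=> h i; have := h i I; rewrite /= in_itv/= -ler_distl.
Qed.

Lemma measurable_obox n (c : 'rV[R]_n) e : measurable (obox c e).
Proof.
rewrite (_ : obox c e =
  \bigcap_(i in [set: 'I_n]) [set x | `]c ord0 i - e, c ord0 i + e[%classic (x ord0 i)]).
  apply: fin_bigcap_measurable; first exact: finite_finset.
  by move=> i _; apply: measurable_coord_pre.
apply/seteqP; split=> x /=.
  by move=> h i _ /=; rewrite in_itv/= -ltr_distl.
by move=> h i; have := h i I; rewrite /= in_itv/= -ltr_distl.
Qed.

Lemma nbhs_rVP n (x : 'rV[R]_n) (A : set 'rV[R]_n) :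
  nbhs x A -> exists2 e, 0 < e & forall y, `|y - x| < e -> A y.
Proof.
move=> /nbhs_normP [e /= e0 h]; exists e => // y yx; apply: h => /=.
by rewrite distrC.
Qed.

(** The Borel sets are generated by the coordinates, so an open set has to be
    written as a countable union of cubes; those with rational centres and
    radii [1 / (k + 1)] inside the set suffice. *)
Lemma open_measurable_rV n (A : set 'rV[R]_n) : open A -> measurable A.
Proof.
move=> oA.
pose B (z : 'rV[rat]_n * nat) :=
  obox (map_mx (ratr : rat -> R) z.1) (z.2.+1%:R^-1).
rewrite (_ : A = \bigcup_(z in [set z | B z `<=` A]) B z); last first.
  apply/seteqP; split=> [x Ax|x [z /= zA]]; last exact: zA.
  have /nbhs_rVP[e e0 eA] := open_nbhs_nbhs (conj oA Ax).
  have [k _ ke] : exists2 k : nat, True & 2 * k.+1%:R^-1 < e.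
    have e20 : 0 < e / 2 by rewrite divr_gt0.
    near \oo => k; exists k => //.
    have : k.+1%:R^-1 < e / 2 by near: k; apply: near_infty_natSinv_lt (PosNum e20).
    by rewrite ltr_pdivlMr // mulrC.
  have k0 : 0 < k.+1%:R^-1 :> R by rewrite invr_gt0.
  have /choice[q qP] : forall i, exists q : rat, `|x ord0 i - ratr q| < k.+1%:R^-1.
    move=> i.
    have lt_xk : x ord0 i - k.+1%:R^-1 < x ord0 i + k.+1%:R^-1.
      by rewrite ltrBlDr -addrA ltrDl addr_gt0.
    have [q] := rat_in_itvoo lt_xk.
    by rewrite in_itv/= -ltr_distl => h; exists q; rewrite distrC.
  (* a cube of radius less than e / 2 centred that close to x stays in A *)
  exists (\row_i q i, k) => /=.
    move=> y yB; apply: eA; apply: norm_rV_lt => // i.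
    have := yB i; have := qP i; rewrite !mxE /= => h1 h2.
    apply: le_lt_trans (ke); rewrite mulr_natl mulr2n.
    apply: le_trans (ler_distD (ratr (q i)) _ _) _.
    by rewrite lerD // ltW // distrC.
  by move=> i; rewrite !mxE /=; exact: qP.
rewrite bigcup_mkcond; apply: countable_bigcupT_measurable => [|z].
  exact: countableP.
by case: ifP => // _; exact: measurable_obox.
Unshelve. all: by end_near. Qed.

Lemma continuous_measurable_rV n (f : 'rV[R]_n -> R) :
  continuous f -> measurable_fun setT f.
Proof.
move=> cf; apply: (measurability _ (@measurable_realfun.RGenOpens.measurableE R)).
move=> _ [_ [a [b ->] <-]]; rewrite setTI.
by apply: open_measurable_rV; move/continuousP: cf; apply; exact: interval_open.
Qed.

Lemma lebesgue_box n (c : 'rV[R]_n) e : 0 <= e ->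
  lebesgue_rV R n (box c e) = ((2 * e) ^+ n)%:E.
Proof.
move=> e0; elim: n c => [|n IHn] c.
  by rewrite /= diracE mem_set // => -[].
have -> : lebesgue_rV R n.+1 (box c e) =
    (lebesgue_measure \x lebesgue_rV R n)%E
      (`[c ord0 ord0 - e, c ord0 ord0 + e] `*`
       box (\row_i c ord0 (lift ord0 i)) e).
  rewrite /= /lebesgue_rV_step /pushforward; congr (_ _).
  apply/seteqP; split=> [[t y] /= h|[t y] /= [h1 h2] i].
    split; first by have := h ord0; rewrite rV_cons_ord0 /= in_itv/= -ler_distl.
    by move=> i; have := h (lift ord0 i); rewrite rV_cons_lift mxE.
  have [j ->|->] := unliftP ord0 i.
    by rewrite rV_cons_lift; have := h2 j; rewrite mxE.
  by rewrite rV_cons_ord0 ler_distl; move: h1; rewrite in_itv.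
rewrite product_measure1E //; last exact: measurable_box.
rewrite IHn; rewrite [X in (X * _)%E]lebesgue_measure_itv /= lte_fin exprS EFinM.
case: ltP => h; first by rewrite -EFinD; congr (_%:E * _)%E; lra.
have -> : e = 0 by lra.
by rewrite !mulr0 !mul0e.
Qed.

Lemma lebesgue_bounded n (A : set 'rV[R]_n) :
  measurable A -> bounded_set A -> (lebesgue_rV R n A < +oo)%E.
Proof.
move=> mA [M [_ hM]].
have h : A `<=` box 0 (`|M| + 1).
  move=> x Ax i; rewrite mxE subr0; apply: le_trans (coord_le_norm _ _) _.
  by apply: (hM (`|M| + 1)) => //; rewrite (le_lt_trans (ler_norm M)) // ltrDl.
apply: (@le_lt_trans _ _ (lebesgue_rV R n (box 0 (`|M| + 1)))).
  by apply: le_measure => //; rewrite inE //; exact: measurable_box.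
by rewrite lebesgue_box ?ltry// addr_ge0.
Qed.

Lemma lebesgue_open_gt0 n (A : set 'rV[R]_n) :
  open A -> A !=set0 -> (0 < lebesgue_rV R n A)%E.
Proof.
move=> oA [x Ax].
have /nbhs_rVP[e e0 eA] := open_nbhs_nbhs (conj oA Ax).
apply: (@lt_le_trans _ _ (lebesgue_rV R n (box x (e / 2)))).
  by rewrite lebesgue_box ?divr_ge0 1?ltW// lte_fin exprn_gt0 // mulr_gt0 // divr_gt0.
apply: le_measure; rewrite ?inE; [exact: measurable_box|exact: open_measurable_rV|].
move=> y yx; apply: eA; apply: norm_rV_lt => // i.
by rewrite !mxE; apply: le_lt_trans (yx i) _; lra.
Qed.

End rV_measure.

(** * Integration by parts *)

Section bounded_support.
Variable R : realType.

Definition bdd_supp n (f : 'rV[R]_n -> R) :=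
  exists2 M, 0 <= M & forall x, M < `|x| -> f x = 0.

Lemma closed_norm_le n M : closed [set x : 'rV[R]_n | `|x| <= M].
Proof.
rewrite (_ : [set _ | _] = Num.norm @^-1` [set y : R | y <= M]) //.
apply: closed_comp; last exact: closed_le.
by move=> x _; exact: norm_continuous.
Qed.

Lemma compact_norm_le n M : compact [set x : 'rV[R]_n | `|x| <= M].
Proof.
apply: bounded_closed_compact; last exact: closed_norm_le.
exists M; split; first exact: num_real.
by move=> y My x /= xM; apply: le_trans xM _; exact: ltW.
Qed.

Lemma bdd_supp_bounded n (g : 'rV[R]_n -> R) : continuous g -> bdd_supp g ->
  exists2 C, 0 <= C & forall x, `|g x| <= C.
Proof.
move=> cg [M M0 gM].
have := continuous_compact (continuous_subspaceT cg) (@compact_norm_le n M).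
move=> /compact_bounded [C [_ hC]].
exists (`|C| + 1); first by rewrite addr_ge0.
move=> x; case: (leP `|x| M) => xM.
  apply: (hC (`|C| + 1)); last by exists x.
  by rewrite (le_lt_trans (ler_norm C)) // ltrDl.
by rewrite gM // normr0 addr_ge0.
Qed.

Lemma bdd_supp_integrable n (g : 'rV[R]_n -> R) : continuous g -> bdd_supp g ->
  (lebesgue_rV R n).-integrable setT (EFin \o g).
Proof.
move=> cg sg; have [C C0 gC] := bdd_supp_bounded cg sg.
have [M M0 gM] := sg.
pose A := [set x : 'rV[R]_n | `|x| <= M].
have mA : measurable A.
  rewrite -[A]setCK; apply: measurableC; apply: open_measurable_rV.
  by rewrite openC; exact: closed_norm_le.
have Afin : (lebesgue_rV R n A < +oo)%E.
  apply: lebesgue_bounded => //; apply: compact_bounded.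
  exact: compact_norm_le.
apply: (@le_integrable _ _ _ _ _ measurableT _ (fun x => ((C%:E * (\1_A x)%:E)%E))).
- by apply/measurable_EFinP; exact: continuous_measurable_rV.
- move=> x _ /=; rewrite lee_fin indicE.
  case: (boolP (x \in A)) => [xA|]; first by rewrite mulr1 (ger0_norm C0).
  rewrite notin_setE /A /= => /negP; rewrite -ltNge => /gM ->.
  by rewrite normr0.
- apply: integrableZl => //.
  apply/integrableP; split; first exact/measurable_EFinP.
  under eq_integral do rewrite gee0_abs ?lee_fin //.
  by rewrite integral_indic // setIT.
Qed.

End bounded_support.

Section integral_partial.
Variable R : realType.

Lemma continuous_1lip (V W : normedModType R) (f : V -> W) :
  (forall x y, `|f x - f y| <= `|x - y|) -> continuous f.
Proof.
move=> f1 x; apply/cvgrPdist_lt => e e0; apply/nbhs_normP; exists e => // y /=.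
exact: le_lt_trans.
Qed.

Lemma continuous_rV_consr n (t : R) :
  continuous (fun y : 'rV[R]_n => rV_cons (t, y)).
Proof.
apply: continuous_1lip => y z; apply: norm_rV_le => // i.
have [j ->|->] := unliftP ord0 i; last first.
  by rewrite !mxE !unlift_none subrr normr0.
by have := coord_le_norm (y - z) j; rewrite !mxE !liftK.
Qed.

Lemma continuous_rV_consl n (y : 'rV[R]_n) :
  continuous (fun t : R => rV_cons (t, y)).
Proof.
apply: (@continuous_1lip R^o) => t s; apply: norm_rV_le => // i.
have [j ->|->] := unliftP ord0 i.
  by rewrite !mxE !liftK subrr normr0.
by rewrite !mxE !unlift_none.
Qed.

Lemma rV_cons_shiftr n (t h : R) (y : 'rV[R]_n) j :
  h *: delta_mx ord0 (lift ord0 j) + rV_cons (t, y) =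
  rV_cons (t, h *: delta_mx ord0 j + y).
Proof.
apply/rowP => i; rewrite !mxE.
have [k ->|->] := unliftP ord0 i.
  by rewrite /= !mxE !eqxx /= (inj_eq lift_inj).
by rewrite /= mulr0 add0r.
Qed.

Lemma rV_cons_shiftl n (t h : R) (y : 'rV[R]_n) :
  h *: delta_mx ord0 ord0 + rV_cons (t, y) = rV_cons (h + t, y).
Proof.
apply/rowP => i; rewrite !mxE.
have [k ->|->] := unliftP ord0 i.
  by rewrite /= mulr0 add0r.
by rewrite /= mulr1.
Qed.

Lemma norm_rV_consl n (t : R) (y : 'rV[R]_n) : `|t| <= `|rV_cons (t, y)|.
Proof.
by apply: le_trans (coord_le_norm _ ord0); rewrite rV_cons_ord0.
Qed.

Lemma norm_rV_consr n (t : R) (y : 'rV[R]_n) : `|y| <= `|rV_cons (t, y)|.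
Proof.
apply: norm_rV_le => // i.
by apply: le_trans (coord_le_norm _ (lift ord0 i)); rewrite rV_cons_lift.
Qed.

Lemma derive_local0 (V : normedModType R) (f : V -> R) x v :
  (\forall y \near x, f y = 0) -> 'D_v f x = 0.
Proof.
move=> f0; rewrite (near_eq_derive (g := cst 0)) ?derive_cst //.
Qed.

Lemma bdd_supp_partial n (f : 'rV[R]_n -> R) i : bdd_supp f ->
  bdd_supp (partial i f).
Proof.
move=> [M M0 fM]; exists M => // x Mx; apply: derive_local0.
have : open [set y : 'rV[R]_n | M < `|y|].
  rewrite (_ : [set _ | _] = ~` [set y | `|y| <= M]).
    by rewrite openC; exact: closed_norm_le.
  by apply/seteqP; split=> y /=; rewrite ltNge => /negP.
move=> oM; have : nbhs x [set y : 'rV[R]_n | M < `|y|] by exact: open_nbhs_nbhs.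
by apply: filterS => y; exact: fM.
Qed.

(** Fubini's theorem in both orders, for the identification of [R^(n+1)] with
    [R * R^n]. *)
Lemma integral_pushforward_cons n
    (l : {sigma_finite_measure set (measurableTypeR R) -> \bar R})
    (m : {sigma_finite_measure set 'rV[R]_n -> \bar R})
    (g : 'rV[R]_n.+1 -> R) :
  (pushforward (l \x m)%E (@rV_cons R n)).-integrable setT (EFin \o g) ->
  (\int[pushforward (l \x m)%E (@rV_cons R n)]_x (g x)%:E =
   \int[l]_t \int[m]_y (g (rV_cons (t, y)))%:E /\
   \int[pushforward (l \x m)%E (@rV_cons R n)]_x (g x)%:E =
   \int[m]_y \int[l]_t (g (rV_cons (t, y)))%:E)%E.
Proof.
move=> /integrableP[mg ig].
have mcons : measurable_fun [set: measurableTypeR R * 'rV[R]_n] (@rV_cons R n).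
  exact: measurable_rV_cons.
have ig2 : (l \x m)%E.-integrable setT (fun z => (g (rV_cons z))%:E).
  apply/integrableP; split.
    by apply: (measurableT_comp mg mcons).
  move: ig; rewrite (ge0_integral_pushforward mcons) //.
  exact: measurableT_comp.
rewrite (integral_pushforward mcons mg ig2 measurableT).
by rewrite (integral12_prod_meas1 ig2) (integral21_prod_meas1 ig2).
Qed.

Lemma integral_rV_step n (g : 'rV[R]_n.+1 -> R) :
  (lebesgue_rV R n.+1).-integrable setT (EFin \o g) ->
  (\int[lebesgue_rV R n.+1]_x (g x)%:E =
   \int[lebesgue_measure]_t \int[lebesgue_rV R n]_y (g (rV_cons (t, y)))%:E /\
   \int[lebesgue_rV R n.+1]_x (g x)%:E =
   \int[lebesgue_rV R n]_y \int[lebesgue_measure]_t (g (rV_cons (t, y)))%:E)%E.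
Proof.
move=> ig.
pose l : {sigma_finite_measure set (measurableTypeR R) -> \bar R} := @lebesgue_measure R.
have H := @integral_pushforward_cons n l (lebesgue_rV R n) g.
exact: (H ig).
Qed.

Lemma integral_FTC_bdd_supp (F : R -> R) (M : R) : 0 <= M ->
  (forall t, derivable F t 1) -> continuous (derive1 F) ->
  (forall t, M < `|t| -> F t = 0) ->
  (\int[lebesgue_measure]_t (derive1 F t)%:E = 0)%E.
Proof.
move=> M0 dF cF' FM.
have F'M t : M < `|t| -> derive1 F t = 0.
  move=> Mt; rewrite derive1E; apply: derive_local0.
  have : open [set y : R | M < `|y|].
    rewrite (_ : [set _ | _] = Num.norm @^-1` [set y | M < y]) //.
    by apply: open_comp => [x _|]; [exact: norm_continuous|exact: open_gt].
  move=> oM; have : nbhs t [set y : R | M < `|y|] by exact: open_nbhs_nbhs.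
  by apply: filterS => y; exact: FM.
have cF t : {for t, continuous F}.
  by apply: differentiable_continuous; apply/derivable1_diffP.
(* outside of this segment both F and its derivative vanish *)
transitivity (\int[lebesgue_measure]_(t in `[(- (M + 1))%R, (M + 1)%R]) (derive1 F t)%:E)%E.
  rewrite [RHS]integral_mkcond; apply: eq_integral => t _.
  rewrite patchE; case: ifPn => //; rewrite notin_setE /= in_itv/= => h.
  rewrite F'M // ltNge; apply: contra_notN h; rewrite ler_norml => /andP[h1 h2].
  by apply/andP; split; lra.
rewrite (continuous_FTC2 (F := F)).
- by rewrite !FM ?subee // ?normrN ger0_norm; lra.
- lra.
- exact: continuous_subspaceT.
- split; first by move=> ? _; exact: dF.
  + exact/cvg_at_right_filter/cF.
  + exact/cvg_at_left_filter/cF.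
- by [].
Qed.

(** Integration in the [i]-th coordinate first kills the derivative; Fubini,
    through the product structure of the measure, lets any coordinate play that
    role. *)
Lemma integral_partial0 n (f : 'rV[R]_n -> R) i :
  (forall x, derivable f x (delta_mx ord0 i)) -> continuous (partial i f) ->
  bdd_supp f -> (\int[lebesgue_rV R n]_x (partial i f x)%:E = 0)%E.
Proof.
elim: n f i => [|n IHn] f i; first by case: i.
move=> df cf sf; have [M M0 fM] := sf.
have [intl intr] := integral_rV_step
  (bdd_supp_integrable cf (bdd_supp_partial i sf)).
have [j ij|i0] := unliftP ord0 i.
  rewrite intl.
  rewrite integral0_eq // => t _.
  pose ft y := f (rV_cons (t, y)).
  have ftE h y : ft (h *: delta_mx ord0 j + y) =
      f (h *: delta_mx ord0 i + rV_cons (t, y)) by rewrite ij rV_cons_shiftr.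
  have quotE y :
      (fun h => h^-1 *: ((ft \o shift y) (h *: delta_mx ord0 j) - ft y)) =
      (fun h => h^-1 *: ((f \o shift (rV_cons (t, y))) (h *: delta_mx ord0 i) -
                         f (rV_cons (t, y)))).
    by apply/funext => h /=; rewrite ftE.
  have pE y : partial j ft y = partial i f (rV_cons (t, y)).
    by rewrite /partial /derive quotE.
  under eq_integral do rewrite -pE.
  apply: IHn.
  - by move=> y; have := df (rV_cons (t, y)); rewrite /derivable quotE.
  - rewrite (_ : partial j ft = partial i f \o (fun y => rV_cons (t, y))).
      move=> y; apply: continuous_comp; first exact: continuous_rV_consr.
      exact: cf.
    by apply/funext => y; rewrite pE.
  - exists M => // y My; apply: fM; apply: lt_le_trans My _.
    exact: norm_rV_consr.
rewrite intr.
rewrite integral0_eq // => y _.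
pose fy t := f (rV_cons (t, y)).
have fyE h t : fy (h *: 1 + t) = f (h *: delta_mx ord0 i + rV_cons (t, y)).
  by rewrite i0 rV_cons_shiftl scaler1.
have quotE t :
    (fun h => h^-1 *: ((fy \o shift t) (h *: 1) - fy t)) =
    (fun h => h^-1 *: ((f \o shift (rV_cons (t, y))) (h *: delta_mx ord0 i) -
                       f (rV_cons (t, y)))).
  by apply/funext => h /=; rewrite fyE.
have pE t : derive1 fy t = partial i f (rV_cons (t, y)).
  by rewrite derive1E /partial /derive quotE.
under eq_integral do rewrite -pE.
apply: (integral_FTC_bdd_supp M0).
- by move=> t; have := df (rV_cons (t, y)); rewrite /derivable quotE.
- rewrite (_ : derive1 fy = partial i f \o (fun t => rV_cons (t, y))).
    move=> t; apply: continuous_comp; first exact: continuous_rV_consl.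
    exact: cf.
  by apply/funext => t; rewrite pE.
- move=> t Mt; apply: fM; apply: lt_le_trans Mt _; exact: norm_rV_consl.
Qed.

End integral_partial.

(** * Smooth functions *)

Section calculus.
Variables (R : realType) (n : nat).
Local Notation E := 'rV[R]_n.
Implicit Types (f g : E -> R) (i : 'I_n).

Lemma partialM f g i x : differentiable f x -> differentiable g x ->
  partial i (fun y => f y * g y) x = f x * partial i g x + g x * partial i f x.
Proof. by move=> /diff_derivable df /diff_derivable dg; exact: deriveM. Qed.

Lemma partialD f g i x : differentiable f x -> differentiable g x ->
  partial i (fun y => f y + g y) x = partial i f x + partial i g x.
Proof. by move=> /diff_derivable df /diff_derivable dg; exact: deriveD. Qed.

Lemma partial_cst (c : R) i : partial i (fun _ : E => c) = fun=> 0.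
Proof. by apply/funext => x; exact: derive_cst. Qed.

Lemma partialZ c f i x : differentiable f x ->
  partial i (fun y => c * f y) x = c * partial i f x.
Proof.
move=> df; rewrite partialM //.
by rewrite partial_cst mulr0 addr0.
Qed.

Lemma partialV f i x : f x != 0 -> differentiable f x ->
  partial i (fun y => (f y)^-1) x = - (f x) ^- 2 * partial i f x.
Proof. by move=> fx /diff_derivable df; exact: deriveV. Qed.

Lemma differentiable_sqrt_comp f x : 0 < f x -> differentiable f x ->
  differentiable (fun y => Num.sqrt (f y)) x.
Proof.
move=> fx df; apply: (@differentiable_comp _ _ _ _ f Num.sqrt) => //.
by apply/derivable1_diffP; have [] := is_derive1_sqrt fx.
Qed.

Lemma partial_sqrt f i x : 0 < f x -> differentiable f x ->
  partial i (fun y => Num.sqrt (f y)) x = (2 * Num.sqrt (f x))^-1 * partial i f x.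
Proof.
move=> fx df; have [ds vs] := is_derive1_sqrt fx.
rewrite /partial deriveE; last exact: differentiable_sqrt_comp.
rewrite (@diff_comp _ _ _ _ f Num.sqrt) //; last exact/derivable1_diffP.
rewrite /= deriv1E // derive1E vs -deriveE //=.
exact: mulrC.
Qed.

Lemma class_CS k f : class_C k.+1 f -> class_C k f.
Proof.
elim: k f => [|k IHk] f [df pf].
  by move=> x; apply: differentiable_continuous; exact: df.
by split=> // i; apply: IHk; exact: pf.
Qed.

Lemma class_C_cst k c : class_C k (fun _ : E => c).
Proof.
elim: k c => [|k IHk] c; first exact: cst_continuous.
split=> [x|i]; first exact: differentiable_cst.
by rewrite partial_cst; exact: IHk.
Qed.

Lemma class_CD k f g : class_C k f -> class_C k g ->
  class_C k (fun x => f x + g x).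
Proof.
elim: k f g => [|k IHk] f g.
  by move=> cf cg x; apply: continuousD; [exact: cf|exact: cg].
move=> [df pf] [dg pg]; split=> [x|i]; first exact: differentiableD.
rewrite (_ : partial i _ = fun x => partial i f x + partial i g x).
  by apply: IHk; [exact: pf|exact: pg].
by apply/funext => x; rewrite partialD.
Qed.

Lemma class_CM k f g : class_C k f -> class_C k g ->
  class_C k (fun x => f x * g x).
Proof.
elim: k f g => [|k IHk] f g.
  by move=> cf cg x; apply: continuousM; [exact: cf|exact: cg].
move=> cf cg; have [[df pf] [dg pg]] := (cf, cg).
split=> [x|i]; first exact: differentiableM.
rewrite (_ : partial i _ =
    fun x => f x * partial i g x + g x * partial i f x).
  apply: class_CD; apply: IHk.
  - exact: class_CS.
  - exact: pg.
  - exact: class_CS.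
  - exact: pf.
by apply/funext => x; rewrite partialM.
Qed.

Section smooth_abs.
Variables (e : R) (f : E -> R).
Hypotheses (e0 : 0 < e) (sf : smooth f).

Let h x := f x * f x + e * e.
Let h_gt0 x : 0 < h x.
Proof. by rewrite /h ltr_wpDl ?mulr_gt0 // -expr2 sqr_ge0. Qed.

Let s x := Num.sqrt (h x).
Let s_gt0 x : 0 < s x. Proof. by rewrite sqrtr_gt0. Qed.

Let df x : differentiable f x. Proof. by have [] := sf 1. Qed.

Let class_Ch k : class_C k h.
Proof. by apply: class_CD; [apply: class_CM; exact: sf|exact: class_C_cst]. Qed.

Let dh x : differentiable h x. Proof. by have [] := class_Ch 1. Qed.

Let ds x : differentiable s x. Proof. exact: differentiable_sqrt_comp. Qed.

Let partial_s i x : partial i s x = f x * partial i f x * (s x)^-1.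
Proof.
rewrite partial_sqrt // partialD; last 2 first.
- exact: differentiableM.
- exact: differentiable_cst.
rewrite partial_cst addr0 partialM // -/(s x) invfM.
by rewrite -mulr2n -mulr_natl; field; rewrite gt_eqF.
Qed.

Let class_Csinv k : class_C k (fun x => (s x)^-1).
Proof.
elim: k => [|k IHk].
  by move=> x; apply: differentiable_continuous; apply: differentiableV; rewrite ?gt_eqF.
split=> [x|i]; first by apply: differentiableV; rewrite ?gt_eqF.
rewrite (_ : partial i _ = fun x =>
   -1 * (f x * partial i f x * ((s x)^-1 * ((s x)^-1 * (s x)^-1)))).
  apply: class_CM; first exact: class_C_cst.
  apply: class_CM; last by apply: class_CM => //; exact: class_CM.
  by apply: class_CM; [exact: sf|have [_] := sf k.+1; exact].
apply/funext => x; rewrite partialV ?gt_eqF // partial_s.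
by field; rewrite gt_eqF.
Qed.

(** A smooth substitute for [|f|], off by at most [e] and vanishing exactly
    where [f] does. *)
Definition smooth_abs x := Num.sqrt (f x * f x + e * e) - e.

(** The reciprocal of the square root reproduces itself under differentiation,
    up to smooth factors, so its regularity climbs by induction; the square
    root is then the product of its square by its reciprocal. *)
Lemma smooth_smooth_abs : smooth smooth_abs.
Proof.
move=> k; apply: class_CD; last exact: class_C_cst.
rewrite (_ : (fun x => _) = fun x => h x * (s x)^-1); first exact: class_CM.
apply/funext => x; rewrite -[h x]sqr_sqrtr ?ltW // -/(s x) expr2.
by rewrite mulfK // gt_eqF.
Qed.

Lemma partial_smooth_abs i x :
  partial i smooth_abs x = f x / Num.sqrt (f x * f x + e * e) * partial i f x.
Proof.
rewrite (partialD (f := s) (g := fun=> - e)) //.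
by rewrite partial_cst addr0 partial_s mulrAC.
Qed.

Lemma smooth_abs_ge x : `|f x| - e <= smooth_abs x.
Proof.
rewrite lerD2r -[leLHS]ger0_norm // -sqrtr_sqr ler_sqrt.
  by rewrite real_normK ?num_real // expr2 lerDl mulr_ge0 // ltW.
exact: ltW (h_gt0 x).
Qed.

Lemma smooth_abs_ge0 x : 0 <= smooth_abs x.
Proof.
rewrite subr_ge0 -[leLHS](gtr0_norm e0) -sqrtr_sqr ler_sqrt ?(ltW (h_gt0 x)) //.
by rewrite [leLHS]expr2 lerDr -expr2 sqr_ge0.
Qed.

(** The chain rule factor: composing with [sqrt (t ^ 2 + e ^ 2) - e] does not
    lengthen gradients. *)
Lemma smooth_abs_slope x : `|f x / Num.sqrt (f x * f x + e * e)| <= 1.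
Proof.
rewrite normrM normfV ler_pdivrMr ?mul1r; last by rewrite normr_gt0 gt_eqF // s_gt0.
rewrite [leRHS]ger0_norm ?sqrtr_ge0 // -sqrtr_sqr ler_sqrt ?(ltW (h_gt0 x)) //.
by rewrite [leLHS]expr2 lerDl mulr_ge0 // ltW.
Qed.

Lemma smooth_abs_neq0 x : (smooth_abs x != 0) = (f x != 0).
Proof.
apply/idP/idP; apply: contra_neq; rewrite /smooth_abs.
  by move=> ->; rewrite mul0r add0r -expr2 sqrtr_sqr (gtr0_norm e0) subrr.
move/eqP; rewrite subr_eq0 => /eqP he.
have : Num.sqrt (f x * f x + e * e) ^+ 2 = e ^+ 2 by rewrite he.
rewrite sqr_sqrtr ?(ltW (h_gt0 x)) // expr2 => /eqP.
by rewrite -subr_eq0 addrK -expr2 sqrf_eq0 => /eqP.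
Qed.

End smooth_abs.

End calculus.

(** * The Euclidean norm and the spaces [L^p] *)

Section euclidean_norm.
Variables (R : realType) (n : nat).
Local Notation E := 'rV[R]_n.
Implicit Types x y z : E.

Lemma dotrvC x y : dotrv x y = dotrv y x.
Proof. by apply: eq_bigr => i _; rewrite mulrC. Qed.

Lemma dotrvDl x y z : dotrv (x + y) z = dotrv x z + dotrv y z.
Proof. by rewrite -big_split; apply: eq_bigr => i _; rewrite mxE mulrDl. Qed.

Lemma dotrvDr x y z : dotrv z (x + y) = dotrv z x + dotrv z y.
Proof. by rewrite !(dotrvC z) dotrvDl. Qed.

Lemma dotrvZl (a : R) x y : dotrv (a *: x) y = a * dotrv x y.
Proof. by rewrite /dotrv mulr_sumr; apply: eq_bigr => i _; rewrite mxE mulrA. Qed.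

Lemma dotrvZr (a : R) x y : dotrv x (a *: y) = a * dotrv x y.
Proof. by rewrite dotrvC dotrvZl dotrvC. Qed.

Lemma dotrv_ge0 x : 0 <= dotrv x x.
Proof. by apply: sumr_ge0 => i _; rewrite -expr2 sqr_ge0. Qed.

Lemma enorm_ge0 x : 0 <= enorm x.
Proof. exact: sqrtr_ge0. Qed.

Lemma enorm_sqr x : enorm x ^+ 2 = dotrv x x.
Proof. by rewrite sqr_sqrtr // dotrv_ge0. Qed.

Lemma coord_le_enorm x i : `|x ord0 i| <= enorm x.
Proof.
rewrite -sqrtr_sqr ler_sqrt ?dotrv_ge0 // /dotrv (bigD1 i) //= expr2.
by rewrite lerDl; apply: sumr_ge0 => j _; rewrite -expr2 sqr_ge0.
Qed.

Lemma enormZ (a : R) x : enorm (a *: x) = `|a| * enorm x.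
Proof.
rewrite /enorm dotrvZl dotrvZr mulrA -expr2 sqrtrM ?sqr_ge0 //.
by rewrite sqrtr_sqr.
Qed.

Lemma enorm0 : enorm (0 : E) = 0.
Proof. by rewrite -(scale0r 0) enormZ normr0 mul0r. Qed.

(** Cauchy-Schwarz, from the square of [|y| x - |x| y]. *)
Lemma dotrv_le x y : dotrv x y <= enorm x * enorm y.
Proof.
have [y0|y0] := eqVneq (enorm y) 0.
  rewrite y0 mulr0 /dotrv big1 // => i _.
  have := coord_le_enorm y i; rewrite y0 normr_le0 => /eqP ->.
  by rewrite mulr0.
have yp : 0 < enorm y by rewrite lt_def y0 enorm_ge0.
have [x0|x0] := eqVneq (enorm x) 0.
  rewrite x0 mul0r /dotrv big1 // => i _.
  have := coord_le_enorm x i; rewrite x0 normr_le0 => /eqP ->.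
  by rewrite mul0r.
have xp : 0 < enorm x by rewrite lt_def x0 enorm_ge0.
have := dotrv_ge0 (enorm y *: x - enorm x *: y).
rewrite -scaleNr dotrvDl !dotrvDr !dotrvZl !dotrvZr -!enorm_sqr (dotrvC y x).
set a := enorm x in xp *; set b := enorm y in yp *; set d := dotrv x y => h.
have : 0 <= 2 * (a * b) * (a * b - d) by nra.
by rewrite pmulr_rge0 ?subr_ge0 // mulr_gt0 // mulr_gt0.
Qed.

Lemma ler_enormD x y : enorm (x + y) <= enorm x + enorm y.
Proof.
rewrite -[leRHS]ger0_norm ?addr_ge0 ?enorm_ge0 // -sqrtr_sqr.
rewrite ler_sqrt ?sqr_ge0 // dotrvDl !dotrvDr -!enorm_sqr (dotrvC y x).
by have := dotrv_le x y; nra.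
Qed.

Lemma enorm_le_sum x : enorm x <= \sum_(i < n) `|x ord0 i|.
Proof.
rewrite -[leRHS]ger0_norm ?sumr_ge0 // -sqrtr_sqr ler_sqrt ?sqr_ge0 //.
rewrite expr2 mulr_suml; apply: ler_sum => i _.
apply: le_trans (ler_norm _) _; rewrite normrM ler_wpM2l //.
by rewrite (bigD1 i) //= lerDl sumr_ge0.
Qed.

Section measurability.
Variables (D : set E).
Implicit Types G H : E -> E.

Lemma measurable_coord_fun G i :
  measurable_fun D G -> measurable_fun D (fun x => G x ord0 i).
Proof. by move=> mG; exact: (measurableT_comp (@measurable_rV_coord R n i)). Qed.

Lemma measurable_dotrv G H :
  measurable_fun D G -> measurable_fun D H ->
  measurable_fun D (fun x => dotrv (G x) (H x)).
Proof.
move=> mG mH; apply: measurable_sum => i.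
by apply: measurable_funM; exact: measurable_coord_fun.
Qed.

Lemma measurable_enorm G : measurable_fun D G ->
  measurable_fun D (fun x => enorm (G x)).
Proof.
move=> mG; have ms : measurable_fun [set: R] (@Num.sqrt R).
  by apply: continuous_measurable_fun; exact: sqrt_continuous.
exact: (measurableT_comp ms (measurable_dotrv mG mG)).
Qed.

Lemma measurable_enormB G H : measurable_fun D G -> measurable_fun D H ->
  measurable_fun D (fun x => enorm (G x - H x)).
Proof.
move=> mG mH; have ms : measurable_fun [set: R] (@Num.sqrt R).
  by apply: continuous_measurable_fun; exact: sqrt_continuous.
apply: (measurableT_comp ms) => /=; apply: measurable_sum => i.
have mGH : measurable_fun D (fun x => (G x - H x) ord0 i).
  rewrite (_ : (fun x => _) = fun x => G x ord0 i - H x ord0 i).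
    by apply: measurable_funB; exact: measurable_coord_fun.
  by apply/funext => x; rewrite !mxE.
exact: measurable_funM.
Qed.

End measurability.
End euclidean_norm.

Section Lp_norm.
Variables (R : realType) (n : nat).
Local Notation E := 'rV[R]_n.
Local Notation leb := (lebesgue_rV R n).
Variables (Omega : set E) (mO : measurable Omega).

Lemma norm_LpE p (f : E -> R) : 0 < p ->
  norm_Lp Omega p f = ((\int[leb]_(x in Omega) (`|f x| `^ p)%:E) `^ p^-1)%E.
Proof.
move=> p0; rewrite /norm_Lp Lnorm.unlock /Lnorm.body.
apply: (f_equal (fun z => z `^ p^-1)%E).
rewrite [RHS]integral_mkcond; apply: eq_integral => x _ /=.
by rewrite !patchE; case: ifP => // _; rewrite normr0 powR0 // gt_eqF.
Qed.

Lemma norm_Lp_powR p (f : E -> R) : 0 < p ->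
  (norm_Lp Omega p f `^ p = \int[leb]_(x in Omega) (`|f x| `^ p)%:E)%E.
Proof.
move=> p0; rewrite norm_LpE // -poweRrM mulVf ?gt_eqF // poweRe1 //.
by apply: integral_ge0 => x _; rewrite lee_fin powR_ge0.
Qed.

Lemma norm_Lp_ge0 p (f : E -> R) : (0 <= norm_Lp Omega p f)%E.
Proof. exact: Lnorm_ge0. Qed.

Lemma measurable_powR_norm p (f : E -> R) : measurable_fun Omega f ->
  measurable_fun Omega (fun x => (`|f x| `^ p)%:E).
Proof.
move=> mf; apply/measurable_EFinP.
apply: (measurableT_comp (measurable_powR p)).
exact: measurableT_comp.
Qed.

Lemma le_norm_Lp p (f g : E -> R) : 0 < p ->
  measurable_fun Omega f -> measurable_fun Omega g ->
  (forall x, Omega x -> `|f x| <= `|g x|) ->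
  (norm_Lp Omega p f <= norm_Lp Omega p g)%E.
Proof.
move=> p0 mf mg fg; rewrite !(norm_LpE _ p0).
apply: gt0_ler_poweR.
- by rewrite invr_ge0 ltW.
- by rewrite in_itv /= leey andbT integral_ge0 // => x _; rewrite lee_fin powR_ge0.
- by rewrite in_itv /= leey andbT integral_ge0 // => x _; rewrite lee_fin powR_ge0.
apply: ge0_le_integral => //.
- exact: measurable_powR_norm.
- exact: measurable_powR_norm.
- move=> x Ox; rewrite lee_fin ge0_ler_powR ?nnegrE ?(ltW p0) //.
  exact: fg.
Qed.

Lemma norm_LpD p (f g : E -> R) : 1 <= p ->
  measurable_fun Omega f -> measurable_fun Omega g ->
  (norm_Lp Omega p (fun x => f x + g x)%R <=
   norm_Lp Omega p f + norm_Lp Omega p g)%E.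
Proof.
move=> p1 mf mg; rewrite /norm_Lp.
rewrite (_ : EFin \o _ = EFin \o ((f \_ Omega) \+ (g \_ Omega))%R).
  by apply: minkowski_EFin => //; apply/(measurable_restrictT _ mO).
apply/funext => x /=; rewrite !patchE; case: ifP => // _.
by rewrite addr0.
Qed.

Lemma norm_LpZ p c (f : E -> R) : 0 < p -> measurable_fun Omega f ->
  norm_Lp Omega p (fun x => c * f x)%R = (`|c|%:E * norm_Lp Omega p f)%E.
Proof.
move=> p0 mf; rewrite !norm_LpE //.
under eq_integral do rewrite normrM powRM // EFinM.
rewrite ge0_integralZl //; last exact: measurable_powR_norm.
rewrite poweRM ?lee_fin ?powR_ge0 //; last first.
  by apply: integral_ge0 => x _; rewrite lee_fin powR_ge0.
by rewrite poweR_EFin -powRrM mulfV ?gt_eqF // powRr1.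
Qed.

Lemma hoelder_Lp p q (f g : E -> R) : 0 < p -> 0 < q -> p^-1 + q^-1 = 1 ->
  measurable_fun Omega f -> measurable_fun Omega g ->
  (\int[leb]_(x in Omega) (`|f x * g x|)%:E <=
   norm_Lp Omega p f * norm_Lp Omega q g)%E.
Proof.
move=> p0 q0 pq mf mg.
have := @hoelder _ _ _ leb (f \_ Omega) (g \_ Omega) p q.
rewrite Lnorm1 => h; apply: le_trans (h _ _ p0 q0 pq); last 2 first.
- exact/(measurable_restrictT _ mO).
- exact/(measurable_restrictT _ mO).
rewrite [leLHS]integral_mkcond le_eqVlt; apply/orP; left; apply/eqP.
apply: eq_integral => x _ /=; rewrite !patchE; case: ifP => //= _.
by rewrite mul0r normr0.
Qed.

(** Minkowski's inequality for gradients, in the form used to pass from a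
    Sobolev function to a test function close to it. *)
Lemma norm_Lp_enormB p (G H : E -> E) : 1 <= p ->
  measurable_fun Omega G -> measurable_fun Omega H ->
  (norm_Lp Omega p (fun x => enorm (H x)) <=
   norm_Lp Omega p (fun x => enorm (G x)) +
   norm_Lp Omega p (fun x => enorm (G x - H x)))%E.
Proof.
move=> p1 mG mH; have p0 : 0 < p by exact: lt_le_trans p1.
have m1 := measurable_enorm mG.
have m2 := measurable_enormB mG mH.
apply: le_trans (norm_LpD p1 m1 m2).
apply: le_norm_Lp p0 (measurable_enorm mH) (measurable_funD m1 m2) _ => x _.
rewrite !ger0_norm ?addr_ge0 ?enorm_ge0 //.
rewrite -[X in enorm X <= _](subKr (G x)).
apply: le_trans (ler_enormD _ _) _.
by rewrite -scaleN1r enormZ normrN normr1 mul1r.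
Qed.

Hypothesis fO : (leb Omega < +oo)%E.

Lemma norm_Lp_bounded p (f : E -> R) C : 0 < p ->
  measurable_fun Omega f -> (forall x, Omega x -> `|f x| <= C) ->
  (norm_Lp Omega p f < +oo)%E.
Proof.
move=> p0 mf fC; rewrite norm_LpE //; apply: poweR_lty.
apply: (@le_lt_trans _ _ (\int[leb]_(x in Omega) (`|C| `^ p)%:E)%E).
  apply: ge0_le_integral => //.
  - exact: measurable_powR_norm.
  - move=> x Ox; rewrite lee_fin ge0_ler_powR ?nnegrE ?(ltW p0) //.
    by apply: le_trans (fC _ Ox) _; exact: ler_norm.
by rewrite integral_cst // lte_mul_pinfty // lee_fin powR_ge0.
Qed.

End Lp_norm.

(** * Test functions as Sobolev functions *)

Section test_functions.
Variables (R : realType) (n : nat).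
Local Notation E := 'rV[R]_n.
Local Notation leb := (lebesgue_rV R n).
Variable Omega : set E.
Implicit Types (phi psi : E -> R) (i : 'I_n).

Local Notation test := (test_function Omega).

Lemma test_differentiable phi x : test phi -> differentiable phi x.
Proof. by move=> [sphi _ _]; have [] := sphi 1. Qed.

Lemma test_continuous phi : test phi -> continuous phi.
Proof. by move=> [sphi _ _]; exact: (sphi 0). Qed.

Lemma test_partial_continuous phi i : test phi -> continuous (partial i phi).
Proof. by move=> [sphi _ _]; have [_ h] := sphi 1; exact: h. Qed.

Lemma test_bdd_supp phi : test phi -> bdd_supp phi.
Proof.
move=> [_ /compact_bounded[M [_ hM]] _].
exists (`|M| + 1) => [|x xM]; first by rewrite addr_ge0.
apply/eqP; apply: contraT => phix.
have : `|x| <= `|M| + 1.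
  apply: (hM (`|M| + 1)); first by rewrite (le_lt_trans (ler_norm M)) // ltrDl.
  exact: subset_closure.
by rewrite leNgt xM.
Qed.

Lemma test_near0 phi x : test phi -> ~ Omega x -> \forall y \near x, phi y = 0.
Proof.
move=> [_ _ sO] nOx.
have : nbhs x (~` closure [set x | phi x != 0]).
  apply: open_nbhs_nbhs; split; first by rewrite openC; exact: closed_closure.
  by move=> /sO.
apply: filterS => y /= ncl; apply/eqP; apply: contraT => phiy.
by exfalso; apply: ncl; exact: subset_closure.
Qed.

Lemma test_out phi x : test phi -> ~ Omega x -> phi x = 0.
Proof. by move=> tphi nOx; exact: (nbhs_singleton (test_near0 tphi nOx)). Qed.

Lemma test_partial_out phi i x : test phi -> ~ Omega x -> partial i phi x = 0.
Proof. by move=> tphi nOx; apply: derive_local0; exact: test_near0. Qed.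

Lemma partial_scale c phi i : test phi ->
  partial i (fun y => c * phi y) = fun x => c * partial i phi x.
Proof.
by move=> tphi; apply/funext => x; rewrite partialZ //; exact: test_differentiable.
Qed.

Lemma test_scale c phi : c != 0 -> test phi -> test (fun x => c * phi x).
Proof.
move=> c0 tphi; have [sphi cK KO] := tphi.
have suppE : [set x | c * phi x != 0] = [set x | phi x != 0].
  by apply/seteqP; split=> x /=; rewrite mulf_eq0 negb_or c0.
split; rewrite ?suppE // => k.
by apply: class_CM; [exact: class_C_cst|exact: sphi].
Qed.

Lemma test_smooth_abs e phi : 0 < e -> test phi -> test (smooth_abs e phi).
Proof.
move=> e0 [sphi cK KO].
have suppE : [set x | smooth_abs e phi x != 0] = [set x | phi x != 0].
  by apply/seteqP; split=> x /=; rewrite (smooth_abs_neq0 _ e0).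
by split; rewrite ?suppE //; exact: smooth_smooth_abs.
Qed.

Lemma enorm_grad_smooth_abs e phi x : 0 < e -> test phi ->
  enorm (grad (smooth_abs e phi) x) <= enorm (grad phi x).
Proof.
move=> e0 [sphi _ _].
rewrite (_ : grad (smooth_abs e phi) x =
    (phi x / Num.sqrt (phi x * phi x + e * e)) *: grad phi x).
  by rewrite enormZ ler_piMl ?enorm_ge0 //; exact: smooth_abs_slope.
by apply/rowP => i; rewrite !mxE partial_smooth_abs.
Qed.

Lemma measurable_test phi : measurable Omega -> test phi ->
  measurable_fun Omega phi.
Proof.
move=> mO tphi; apply: measurable_funTS.
by apply: continuous_measurable_rV; exact: test_continuous.
Qed.

Lemma measurable_grad phi : measurable Omega -> test phi ->
  measurable_fun Omega (grad phi).
Proof.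
move=> mO tphi; apply: measurable_funTS; apply: measurable_fun_rVP => i.
rewrite (_ : _ \o _ = partial i phi).
  by apply: continuous_measurable_rV; exact: test_partial_continuous.
by apply/funext => x; rewrite /rV_coord /= mxE.
Qed.

Lemma enorm_grad_bounded phi : test phi ->
  exists C, forall x, `|enorm (grad phi x)| <= C.
Proof.
move=> tphi.
have /choice[C hC] : forall i, exists C, forall x, `|partial i phi x| <= C.
  move=> i; have [] := bdd_supp_bounded (@test_partial_continuous _ i tphi).
    exact/bdd_supp_partial/test_bdd_supp.
  by move=> C _ hC; exists C.
exists (\sum_i C i) => x; rewrite ger0_norm ?enorm_ge0 //.
apply: le_trans (enorm_le_sum _) _; apply: ler_sum => i _.
by rewrite mxE; exact: hC.
Qed.

(** The product of [f] with a test function has bounded support, so the integral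
    of its partial derivative vanishes. *)
Lemma integral_test_by_parts (f : E -> R) psi i :
  measurable Omega -> (forall x, differentiable f x) ->
  continuous (partial i f) -> test psi ->
  (\int[leb]_(x in Omega) (f x * partial i psi x)%:E =
   - \int[leb]_(x in Omega) (partial i f x * psi x)%:E)%E.
Proof.
move=> mO df cf tpsi.
have cf0 : continuous f by move=> x; apply: differentiable_continuous.
have cpsi := test_continuous tpsi.
have cppsi := @test_partial_continuous _ i tpsi.
have [M M0 psiM] := test_bdd_supp tpsi.
have [M' M'0 ppsiM] := bdd_supp_partial i (test_bdd_supp tpsi).
have restrictE (g : E -> R) : (forall x, ~ Omega x -> g x = 0) ->
    (\int[leb]_(x in Omega) (g x)%:E = \int[leb]_x (g x)%:E)%E.
  move=> g0; rewrite [LHS]integral_mkcond; apply: eq_integral => x _.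
  rewrite patchE; case: ifPn => // /negP; rewrite inE => nO.
  by rewrite g0.
have i1 : leb.-integrable setT (EFin \o (fun x => f x * partial i psi x)).
  apply: bdd_supp_integrable; first by move=> x; apply: continuousM; [exact: cf0|exact: cppsi].
  by exists M' => // x Mx; rewrite ppsiM // mulr0.
have i2 : leb.-integrable setT (EFin \o (fun x => partial i f x * psi x)).
  apply: bdd_supp_integrable; first by move=> x; apply: continuousM; [exact: cf|exact: cpsi].
  by exists M => // x Mx; rewrite psiM // mulr0.
rewrite !restrictE; last 2 first.
- by move=> x nOx; rewrite (test_out tpsi nOx) mulr0.
- by move=> x nOx; rewrite (@test_partial_out _ i _ tpsi nOx) mulr0.
have pE : partial i (fun x => f x * psi x) =
    fun x => f x * partial i psi x + partial i f x * psi x.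
  apply/funext => x; rewrite partialM //; last exact: test_differentiable.
  by rewrite [psi x * _]mulrC.
have : (\int[leb]_x (partial i (fun x => f x * psi x)%R x)%:E = 0)%E.
  apply: integral_partial0.
  - move=> x; apply: diff_derivable; apply: differentiableM => //.
    exact: test_differentiable.
  - rewrite pE; apply: (@class_CD _ _ 0); exact: (@class_CM _ _ 0).
  - by exists M => // x Mx; rewrite psiM // mulr0.
rewrite pE; under eq_integral do rewrite EFinD.
have fin2 := integrable_fin_num measurableT i2.
rewrite integralD // => /(congr1 (fun z => z - \int[leb]_x (partial i f x * psi x)%:E)%E).
by rewrite addeK // add0e.
Qed.

(** A test function approximates itself; what needs a proof is that its
    classical gradient is a weak one. *)
Lemma W01p_test p phi : 0 < p -> measurable Omega -> (leb Omega < +oo)%E ->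
  test phi -> W01p Omega p phi (grad phi).
Proof.
move=> p0 mO fO tphi.
have mphi := measurable_test mO tphi.
have mg := measurable_grad mO tphi.
split; last first.
  move=> e e0; exists phi => //.
  rewrite !(norm_LpE _ _ p0).
  under eq_integral do rewrite subrr normr0 powR0 ?gt_eqF //.
  under [X in (_ + X `^ _)%E]eq_integral do
    rewrite subrr enorm0 normr0 powR0 ?gt_eqF //.
  by rewrite integral0 poweR0r ?adde0 ?lte_fin // gt_eqF // invr_gt0.
split.
- split=> //; have [C _ hC] := bdd_supp_bounded (test_continuous tphi) (test_bdd_supp tphi).
  by apply: (norm_Lp_bounded mO fO p0 mphi (C := C)) => x _.
- split=> //; have [C hC] := enorm_grad_bounded tphi.
  by apply: (norm_Lp_bounded mO fO p0 (measurable_enorm mg) (C := C)) => x _.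
- move=> psi tpsi i.
  rewrite (integral_test_by_parts (i := i)) //.
  + by under [in RHS]eq_integral do rewrite mxE.
  + by move=> x; exact: test_differentiable.
  + exact: test_partial_continuous.
Qed.

Lemma partial_coord i : partial i (fun x : E => x ord0 i) = fun=> 1.
Proof.
apply/funext => x; rewrite /partial /derive.
have -> : (fun h : R => h^-1 *: (((fun y : E => y ord0 i) \o shift x)
    (h *: delta_mx ord0 i) - x ord0 i)) = (fun h => h^-1 * h).
  by apply/funext => h /=; rewrite !mxE !eqxx mulr1 addrK.
apply: cvg_lim => //.
have : (fun=> 1 : R) @ (0 : R)^' --> (1 : R) by exact: cvg_cst.
apply: cvg_trans; apply: near_eq_cvg; near=> h.
rewrite mulVf //; near: h; exact: nbhs_dnbhs_neq.
Unshelve. all: by end_near. Qed.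

(** Integration by parts against a coordinate function, whose derivative is
    [1]: the identity behind the inequality of Poincare. *)
Lemma integral_test_coord psi i : measurable Omega -> test psi ->
  (\int[leb]_(x in Omega) (psi x)%:E =
   - \int[leb]_(x in Omega) (x ord0 i * partial i psi x)%:E)%E.
Proof.
move=> mO tpsi; rewrite (integral_test_by_parts (f := fun x => x ord0 i)) //.
- by rewrite oppeK; under [RHS]eq_integral do rewrite partial_coord mul1r.
- by move=> x; exact: differentiable_coord.
- by rewrite partial_coord => x; exact: cst_continuous.
Qed.

End test_functions.

(** * Estimates on weak solutions *)

Lemma measurable_invr (R : realType) : measurable_fun [set: R] (@GRing.inv R).
Proof.
rewrite (_ : GRing.inv = fun x : R => x * (x ^+ 2) `^ (-1)).
  apply: measurable_funM => //.
  apply: (measurableT_comp (measurable_powR (-1))).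
  exact: measurable_funX.
apply/funext => x; rewrite powR_inv1 ?sqr_ge0 //.
have [->|x0] := eqVneq x 0; first by rewrite invr0 mul0r.
by field.
Qed.

Lemma normr_dotrv_le (R : realType) n (x y : 'rV[R]_n) :
  `|dotrv x y| <= enorm x * enorm y.
Proof.
rewrite ler_norml dotrv_le andbT lerNl.
have := dotrv_le (- x) y; rewrite -scaleN1r dotrvZl enormZ normrN normr1.
by rewrite !mulN1r mul1r.
Qed.

Lemma powRB1M (R : realType) (a p : R) : 1 < p -> 0 <= a ->
  a `^ (p - 2) * a = a `^ (p - 1).
Proof.
move=> p1; rewrite le_eqVlt => /predU1P[<-|a0].
  by rewrite mulr0 powR0 // gt_eqF // subr_gt0.
rewrite -[X in _ * X = _]powRr1 ?ltW // -powRD; last by rewrite (gt_eqF a0) implybT.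
by congr (_ `^ _); ring.
Qed.

Section domain.
Variables (R : realType) (n : nat).
Local Notation E := 'rV[R]_n.
Local Notation leb := (lebesgue_rV R n).
Variables (p : R) (Omega : set E).
Hypotheses (p1 : 1 < p) (oO : open Omega) (bO : bounded_set Omega)
  (nO : Omega !=set0).

Let V := fine (leb Omega).

Let p0 : 0 < p. Proof. exact: lt_trans p1. Qed.

Let mO : measurable Omega. Proof. exact: open_measurable_rV. Qed.

Let fO : (leb Omega < +oo)%E. Proof. exact: lebesgue_bounded. Qed.

Lemma volE : leb Omega = V%:E.
Proof. by rewrite fineK // ge0_fin_numE. Qed.

Lemma vol_gt0 : 0 < V.
Proof. by rewrite fine_gt0 // fO lebesgue_open_gt0. Qed.

Lemma integral_cst_Omega (c : R) :
  (\int[leb]_(x in Omega) c%:E = (c * V)%:E)%E.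
Proof. by rewrite integral_cst // EFinM -volE. Qed.

Let q := p / (p - 1).

Let q0 : 0 < q. Proof. by rewrite divr_gt0 // subr_gt0. Qed.

Let pq1 : q^-1 + p^-1 = 1.
Proof. by rewrite /q invf_div -{2}[p^-1]mul1r -mulrDl subrK divff // gt_eqF. Qed.

Lemma W1p_measurable v G : W1p Omega p v G -> measurable_fun Omega v.
Proof. by move=> [[]]. Qed.

Lemma W1p_measurable_grad v G : W1p Omega p v G -> measurable_fun Omega G.
Proof. by move=> [_ []]. Qed.

(** Positivity is only assumed on compact sets: the points at distance at least
    [1 / (k + 1)] from the complement, in the ball of radius [k], form compact
    sets that exhaust [Omega]. *)
Let exhaustion k : set E :=
  [set x | `|x| <= k%:R] `&`
  \bigcap_(y in ~` Omega) [set x | k.+1%:R^-1 <= `|y - x|].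

Lemma compact_exhaustion k : compact (exhaustion k).
Proof.
apply: bounded_closed_compact.
  exists k%:R; split; first exact: num_real.
  by move=> M kM x [/= xk _]; apply: le_trans xk _; exact: ltW.
apply: closedI; first exact: closed_norm_le.
apply: closed_bigI => y _.
rewrite (_ : [set x | _] =
    (fun x => `|y - x|) @^-1` [set r : R | k.+1%:R^-1 <= r]) //.
apply: closed_comp; last exact: closed_ge.
move=> x _; apply: (@continuous_1lip _ E R^o) => z t.
apply: le_trans (ler_dist_dist _ _) _.
by rewrite opprB addrC addrA subrK distrC.
Qed.

Lemma exhaustion_sub k : exhaustion k `<=` Omega.
Proof.
move=> x [_ /= h]; apply: contrapT => nOx.
by have /= := h x nOx; rewrite subrr normr0 leNgt invr_gt0 ltr0Sn.
Qed.

Lemma exhaustion_cover x : Omega x -> exists k, exhaustion k x.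
Proof.
move=> Ox.
have /nbhs_rVP[e e0 eO] := open_nbhs_nbhs (conj oO Ox).
near \oo => k; exists k; split => /=.
  near: k; apply: nbhs_infty_ger.
move=> y /= nOy; rewrite leNgt; apply/negP => yx; apply: nOy.
apply: eO; apply: lt_trans yx _.
by near: k; exact: (near_infty_natSinv_lt (PosNum e0)).
Unshelve. all: by end_near. Qed.

(** [weak_solution] with the gradient, there bound by an existential, made
    explicit. *)
Definition solves lambda v G : Prop := [/\ W01p Omega p v G,
  forall K, compact K -> K `<=` Omega -> (0 < ess_inf_on K v)%E &
  forall phi Gphi, W01p Omega p phi Gphi ->
    leb.-integrable Omega (fun x => ((v x)^-1 * phi x)%:E) /\
    (\int[leb]_(x in Omega)
      (enorm (G x) `^ (p - 2) * dotrv (G x) (Gphi x))%:E =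
      lambda%:E * \int[leb]_(x in Omega) ((v x)^-1 * phi x)%:E)%E].

Lemma weak_solutionP lambda v :
  weak_solution Omega p lambda v <-> exists G, solves lambda v G.
Proof. by split=> [[G ? [? ?]]|[G [? ? ?]]]; exists G. Qed.

Let volq := V `^ (1 - p^-1).

(** Hoelder's inequality against the constant [1]. *)
Lemma integral_le_norm_Lp (f : E -> R) : measurable_fun Omega f ->
  (\int[leb]_(x in Omega) `|f x|%:E <= volq%:E * norm_Lp Omega p f)%E.
Proof.
move=> mf.
have := hoelder_Lp mO q0 p0 pq1 (@measurable_cst _ _ _ _ _ (1 : R)) mf.
under eq_integral do rewrite mul1r.
rewrite (norm_LpE _ _ q0).
under [X in (X `^ _)%E]eq_integral do rewrite normr1 powR1.
rewrite integral_cst_Omega mul1r poweR_EFin.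
by rewrite (_ : q^-1 = 1 - p^-1) // -pq1 addrK.
Qed.

Section solution.
Variables (lambda : R) (v : E -> R) (G : E -> E).
Hypotheses (l0 : 0 <= lambda) (sol : solves lambda v G).

Let Wv : W01p Omega p v G. Proof. by case: sol. Qed.

Let mv : measurable_fun Omega v. Proof. exact: W1p_measurable (proj1 Wv). Qed.

Let mG : measurable_fun Omega G.
Proof. exact: W1p_measurable_grad (proj1 Wv). Qed.

Let mvinv : measurable_fun Omega (fun x => (v x)^-1).
Proof. exact: (measurableT_comp (@measurable_invr R) mv). Qed.

(** Countably many compact sets exhaust [Omega], so the exceptional null sets
    add up to a null set. *)
Lemma solution_gt0 : {ae leb, forall x, Omega x -> 0 < v x}.
Proof.
have : {ae leb, forall x, forall k, exhaustion k x -> 0 < v x}.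
  apply: ae_foralln => k.
  have [_ vK _] := sol.
  have Kk := vK _ (@compact_exhaustion k) (@exhaustion_sub k).
  have := ess_inf_le leb (patch (cst +oo%E) (exhaustion k) (EFin \o v)).
  apply: filterS => x /=; rewrite -/(ess_inf_on (exhaustion k) v) => h Kx.
  move: h; rewrite /patch mem_set // => /(lt_le_trans Kk).
  by rewrite lte_fin.
apply: filterS => x h Ox; have [k Kx] := exhaustion_cover Ox.
exact: h Kx.
Qed.

(** The solution is an admissible test function for itself, and the singular
    integrand is then the constant [1]. *)
Lemma solution_energy :
  (\int[leb]_(x in Omega) (`|enorm (G x)| `^ p)%:E = (lambda * V)%:E)%E.
Proof.
have [_ _ v_eq] := sol; have [_ E] := v_eq _ _ Wv.
transitivity (\int[leb]_(x in Omega)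
    (enorm (G x) `^ (p - 2) * dotrv (G x) (G x))%:E)%E.
  apply: eq_integral => x _; congr (_%:E).
  rewrite ger0_norm ?enorm_ge0 // -enorm_sqr expr2 mulrA powRB1M ?enorm_ge0 //.
  by rewrite mulrC mulr_powRB1 ?enorm_ge0.
rewrite E EFinM -[V]mul1r -integral_cst_Omega; congr (_ * _)%E.
apply: ae_eq_integral => //.
  by apply/measurable_EFinP; exact: measurable_funM.
apply: filterS solution_gt0 => x h Ox /=.
by rewrite mulVf // gt_eqF // h.
Qed.

Lemma solution_norm : norm_Lp Omega p (fun x => enorm (G x)) =
  ((lambda * V) `^ p^-1)%:E.
Proof. by rewrite (norm_LpE _ _ p0) solution_energy poweR_EFin. Qed.

(** [|grad v| ^ (p - 2) grad v] has norm [|grad v| ^ (p - 1)], in the dual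
    exponent [p / (p - 1)]. *)
Lemma solution_flux_norm :
  norm_Lp Omega q (fun x => enorm (G x) `^ (p - 1)) =
  ((lambda * V) `^ (1 - p^-1))%:E.
Proof.
rewrite (norm_LpE _ _ q0).
have -> : (\int[leb]_(x in Omega) (`|enorm (G x) `^ (p - 1)| `^ q)%:E =
  (lambda * V)%:E)%E.
  rewrite -solution_energy; apply: eq_integral => x _; congr (_%:E).
  rewrite ger0_norm ?powR_ge0 // -powRrM ger0_norm ?enorm_ge0 //.
  by congr (_ `^ _); rewrite /q mulrCA mulfV ?mulr1 // gt_eqF // subr_gt0.
rewrite poweR_EFin; congr ((_ `^ _)%:E).
by apply/eqP; rewrite eq_sym subr_eq; apply/eqP; rewrite pq1.
Qed.

(** Hoelder's inequality on the weak formulation. *)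
Lemma solution_pairing phi Gphi : W01p Omega p phi Gphi ->
  (lambda%:E * \int[leb]_(x in Omega) ((v x)^-1 * phi x)%:E <=
   ((lambda * V) `^ (1 - p^-1))%:E *
   norm_Lp Omega p (fun x => enorm (Gphi x)))%E.
Proof.
move=> Wphi; have [_ _ v_eq] := sol; have [_ <-] := v_eq _ _ Wphi.
have mGphi := W1p_measurable_grad (proj1 Wphi).
have mflux (a : R) : measurable_fun Omega (fun x => enorm (G x) `^ a).
  exact: (measurableT_comp (measurable_powR a) (measurable_enorm mG)).
rewrite -solution_flux_norm.
apply: le_trans (hoelder_Lp mO q0 p0 pq1 (mflux _) (measurable_enorm mGphi)).
apply: le_trans (lee_abs _) _.
have mint : measurable_fun Omega
    (fun x => (enorm (G x) `^ (p - 2) * dotrv (G x) (Gphi x))%:E).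
  by apply/measurable_EFinP; apply: measurable_funM => //; exact: measurable_dotrv.
apply: le_trans (le_abse_integral leb mO mint) _.
apply: ge0_le_integral => //.
- exact: measurableT_comp.
- apply/measurable_EFinP; apply: measurableT_comp => //.
  by apply: measurable_funM => //; exact: measurable_enorm.
- move=> x _; rewrite lee_fin normrM ger0_norm ?powR_ge0 //.
  rewrite -powRB1M ?enorm_ge0 // -mulrA [leRHS]ger0_norm; last first.
    by rewrite mulr_ge0 ?powR_ge0 // mulr_ge0 ?enorm_ge0.
  by rewrite ler_wpM2l ?powR_ge0 // normr_dotrv_le.
Qed.

Lemma integral_solution_abs (h : E -> R) : measurable_fun Omega h ->
  (forall x, 0 <= h x) ->
  (\int[leb]_(x in Omega) `|(v x)^-1 * h x|%:E =
   \int[leb]_(x in Omega) ((v x)^-1 * h x)%:E)%E.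
Proof.
move=> mh h0; apply: ae_eq_integral => //.
- apply/measurable_EFinP; apply: measurableT_comp => //.
  exact: measurable_funM.
- by apply/measurable_EFinP; exact: measurable_funM.
- apply: filterS solution_gt0 => x h1 Ox /=.
  by rewrite ger0_norm // mulr_ge0 // invr_ge0 ltW // h1.
Qed.

(** [|phi|] is not a test function, but the smooth functions
    [sqrt (psi ^ 2 + e ^ 2) - e] built on test functions [psi] close to [phi]
    are, and their gradients are shorter than those of [psi].  The weight
    [1 / v] is unbounded, hence the truncation, removed by monotone
    convergence afterwards. *)
Lemma solution_pairing_abs_trunc phi Gphi (k : nat) : W01p Omega p phi Gphi ->
  (lambda%:E * \int[leb]_(x in Omega `&` [set x | (k.+1%:R^-1 <= v x)%R])
     `|(v x)^-1 * phi x|%:E <=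
   ((lambda * V) `^ (1 - p^-1))%:E *
   norm_Lp Omega p (fun x => enorm (Gphi x)))%E.
Proof.
move=> Wphi; set Dk := Omega `&` _.
have mphi := W1p_measurable (proj1 Wphi).
have mGphi := W1p_measurable_grad (proj1 Wphi).
have mDk : measurable Dk by exact: measurable_fun_le.
have DkO : Dk `<=` Omega by move=> x [].
have [[_ [_ Lfin] _] dens] := Wphi.
set L := norm_Lp Omega p (fun x => enorm (Gphi x)) in Lfin *.
have L0 : (0 <= L)%E by exact: norm_Lp_ge0.
have [l lE] : exists l, L = l%:E.
  by exists (fine L); rewrite fineK // ge0_fin_numE.
set C := (lambda * V) `^ (1 - p^-1).
have C0 : 0 <= C by exact: powR_ge0.
have kp : 0 <= k.+1%:R :> R by [].
have vq0 : 0 <= volq by exact: powR_ge0.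
have V0 := ltW vol_gt0.
pose K := lambda * (k.+1%:R * (volq + V)) + C.
have K0 : 0 <= K by rewrite addr_ge0 // !mulr_ge0 // addr_ge0.
(* K * e bounds the total error when psi is e-close to phi *)
apply/lee_addgt0Pr => d d0.
have K10 : 0 < K + 1 by rewrite ltr_wpDl.
have [e e0 eK] : exists2 e, 0 < e & e * (K + 1) = d.
  by exists (d / (K + 1)); rewrite ?divr_gt0 // divfK // gt_eqF.
have e0' := ltW e0.
have [psi tpsi psie] := dens e e0.
have mpsi := measurable_test mO tpsi.
have mgpsi := measurable_grad mO tpsi.
have [n1 n2] : (norm_Lp Omega p (fun x => phi x - psi x)%R <= e%:E)%E /\
    (norm_Lp Omega p (fun x => enorm (Gphi x - grad psi x)) <= e%:E)%E.
  by split; apply: le_trans (ltW psie); [apply: leeDl|apply: leeDr]; exact: norm_Lp_ge0.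
pose h := smooth_abs e psi.
have th : test_function Omega h by exact: test_smooth_abs.
have mh := measurable_test mO th.
have mdiff : measurable_fun Omega (fun x => phi x - psi x).
  exact: measurable_funB.
have mvh : measurable_fun Omega (fun x => (v x)^-1 * h x).
  exact: measurable_funM.
have b1 : (\int[leb]_(x in Dk) `|(v x)^-1 * phi x|%:E <=
    \int[leb]_(x in Omega) (k.+1%:R * (`|phi x - psi x| + e) +
                            `|(v x)^-1 * h x|)%:E)%E.
  apply: (@le_trans _ _ (\int[leb]_(x in Dk)
      (k.+1%:R * (`|phi x - psi x| + e) + `|(v x)^-1 * h x|)%:E)%E).
    apply: ge0_le_integral => //.
    + apply/measurable_EFinP; apply: measurableT_comp => //.
      apply: (measurable_funS mO DkO); exact: measurable_funM.
    + apply/measurable_EFinP; apply: (measurable_funS mO DkO).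
      apply: measurable_funD; last exact: measurableT_comp.
      apply: measurable_funM => //; apply: measurable_funD => //.
      exact: measurableT_comp.
    + move=> x [Ox /= kv]; rewrite lee_fin.
      have v0 : 0 < v x by apply: lt_le_trans kv; rewrite invr_gt0.
      have vk : (v x)^-1 <= k.+1%:R by rewrite invf_ple // posrE.
      have hx : `|psi x| - e <= h x by exact: smooth_abs_ge.
      have h0 : 0 <= h x by exact: smooth_abs_ge0.
      have v10 : 0 <= (v x)^-1 by rewrite invr_ge0 ltW.
      rewrite !normrM (ger0_norm v10) (ger0_norm h0).
      have tri : `|phi x| <= `|phi x - psi x| + e + h x.
        apply: (@le_trans _ _ (`|phi x - psi x| + `|psi x|)).
          by rewrite -[X in `|X| <= _](subrK (psi x)) ler_normD.
        by rewrite -addrA lerD2l -lerBlDl.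
      apply: le_trans (ler_wpM2l v10 tri) _; rewrite mulrDr lerD2r.
      by rewrite ler_wpM2r // addr_ge0 // ltW.
  apply: ge0_subset_integral => //.
    apply/measurable_EFinP; apply: measurable_funD; last exact: measurableT_comp.
    apply: measurable_funM => //; apply: measurable_funD => //.
    exact: measurableT_comp.
  move=> x _; rewrite lee_fin addr_ge0 // mulr_ge0 // addr_ge0 //; exact: ltW.
have b2 : (\int[leb]_(x in Omega) (k.+1%:R * (`|phi x - psi x| + e) +
                            `|(v x)^-1 * h x|)%:E =
    k.+1%:R%:E * (\int[leb]_(x in Omega) `|phi x - psi x|%:E + (e * V)%:E) +
    \int[leb]_(x in Omega) ((v x)^-1 * h x)%:E)%E.
  under eq_integral do rewrite EFinD.
  rewrite ge0_integralD //; last 3 first.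
  - move=> x _; rewrite lee_fin mulr_ge0 // addr_ge0 //; exact: ltW.
  - apply/measurable_EFinP; apply: measurable_funM => //.
    apply: measurable_funD => //; exact: measurableT_comp.
  - by apply/measurable_EFinP; exact: measurableT_comp.
  rewrite integral_solution_abs //; last by move=> x; exact: smooth_abs_ge0.
  congr (_ + _)%E.
  under eq_integral do rewrite EFinM.
  rewrite ge0_integralZl //; last 2 first.
  - apply/measurable_EFinP.
    apply: measurable_funD => //; exact: measurableT_comp.
  - move=> x _; rewrite lee_fin addr_ge0 //; exact: ltW.
  congr (_ * _)%E; under eq_integral do rewrite EFinD.
  rewrite ge0_integralD //; last by apply/measurable_EFinP; exact: measurableT_comp.
  by rewrite integral_cst_Omega.
have b3 : (\int[leb]_(x in Omega) `|phi x - psi x|%:E <= (volq * e)%:E)%E.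
  by apply: le_trans (integral_le_norm_Lp mdiff) _; rewrite EFinM lee_wpmul2l.
have b4 : (lambda%:E * \int[leb]_(x in Omega) ((v x)^-1 * h x)%:E <=
    (C * (l + e))%:E)%E.
  apply: le_trans (solution_pairing (W01p_test p0 mO fO th)) _.
  rewrite EFinM lee_wpmul2l // EFinD -lE.
  apply: (@le_trans _ _ (norm_Lp Omega p (fun x => enorm (grad psi x)))).
    apply: le_norm_Lp; [exact: mO|exact: p0|..].
    - by apply: measurable_enorm; exact: measurable_grad.
    - exact: measurable_enorm.
    - move=> x _; rewrite (ger0_norm (enorm_ge0 _)) (ger0_norm (enorm_ge0 _)).
      exact: enorm_grad_smooth_abs tpsi.
  apply: le_trans (leeD (lexx _) n2).
  exact: norm_Lp_enormB (ltW p1) mGphi mgpsi.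
apply: le_trans (lee_wpmul2l _ b1) _; first by rewrite lee_fin.
rewrite b2 ge0_muleDr; last 2 first.
- rewrite mule_ge0 // adde_ge0 ?lee_fin ?mulr_ge0 //.
  exact: integral_ge0.
- rewrite -integral_solution_abs //; last by move=> x; exact: smooth_abs_ge0.
  exact: integral_ge0.
apply: le_trans (leeD (lexx _) b4) _.
apply: (@le_trans _ _ (lambda * (k.+1%:R * (volq * e + e * V)) + C * (l + e))%:E).
  rewrite EFinD; apply: leeD => //.
  rewrite !EFinM; apply: lee_wpmul2l; first by rewrite lee_fin.
  apply: lee_wpmul2l; first by rewrite lee_fin.
  by rewrite EFinD; apply: leeD => //; rewrite -EFinM.
rewrite lE -EFinM -EFinD lee_fin.
have -> : lambda * (k.+1%:R * (volq * e + e * V)) + C * (l + e) = C * l + K * e.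
  by rewrite /K; ring.
by rewrite lerD2l -eK mulrDr mulr1 [K * e]mulrC lerDl.
Qed.

End solution.

End domain.

Section solution_estimates.
Variables (R : realType) (n : nat).
Local Notation E := 'rV[R]_n.
Local Notation leb := (lebesgue_rV R n).
Variables (p : R) (Omega : set E).
Hypotheses (p1 : 1 < p) (oO : open Omega) (bO : bounded_set Omega)
  (nO : Omega !=set0).

Local Notation V := (fine (leb Omega)).

Let p0 : 0 < p. Proof. exact: lt_trans p1. Qed.

Let mO : measurable Omega. Proof. exact: open_measurable_rV. Qed.

Let fO : (leb Omega < +oo)%E. Proof. exact: lebesgue_bounded. Qed.

(** A nonempty open set is not negligible. *)
Lemma ae_Omega_false : {ae leb, forall x, Omega x -> False} -> False.
Proof.
move=> [N [mN N0 sub]].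
have := lebesgue_open_gt0 oO nO; rewrite ltNge => /negP; apply.
rewrite -N0; apply: le_measure; rewrite ?inE //.
by move=> x Ox; apply: sub => /= h; exact: (h Ox).
Qed.

Variables (lambda : R) (v : E -> R) (G : E -> E).
Hypotheses (l0 : 0 <= lambda) (sol : solves p Omega lambda v G).

Let Wv : W01p Omega p v G. Proof. by case: sol. Qed.

Let mv : measurable_fun Omega v. Proof. exact: W1p_measurable (proj1 Wv). Qed.

Let mvinv : measurable_fun Omega (fun x => (v x)^-1).
Proof. exact: (measurableT_comp (@measurable_invr R) mv). Qed.

(** The truncations to [v >= 1 / (k + 1)] increase to [Omega] up to a null
    set. *)
Lemma solution_pairing_abs phi Gphi : W01p Omega p phi Gphi ->
  (lambda%:E * \int[leb]_(x in Omega) `|(v x)^-1 * phi x|%:E <=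
   ((lambda * V) `^ (1 - p^-1))%:E *
   norm_Lp Omega p (fun x => enorm (Gphi x)))%E.
Proof.
move=> Wphi.
have mphi := W1p_measurable (proj1 Wphi).
pose D k := Omega `&` [set x | k.+1%:R^-1 <= v x].
have mD k : measurable (D k) by exact: measurable_fun_le.
have DO k : D k `<=` Omega by move=> x [].
have mf : measurable_fun Omega (fun x => `|(v x)^-1 * phi x|%:E).
  apply/measurable_EFinP; apply: measurableT_comp => //.
  exact: measurable_funM.
have ndD : {homo D : i j / (i <= j)%N >-> (i <= j)%O}.
  move=> i j ij; apply/subsetPset => x [Ox /= vx]; split => //=.
  by apply: le_trans vx; rewrite lef_pV2 ?posrE // ler_nat.
have cvgD := ge0_nondecreasing_set_cvg_integral (mu := leb) ndD mD
  (fun k => measurable_funS mO (@DO k) mf) (fun k x _ => normr_ge0 _).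
have mU : measurable (\bigcup_k D k) by exact: bigcup_measurable.
have null : leb (Omega `\` \bigcup_k D k) = 0%E.
  have [N [mN N0 sub]] := solution_gt0 oO sol.
  apply/eqP; rewrite eq_le measure_ge0 andbT -N0.
  apply: le_measure; rewrite ?inE //; first exact: measurableD.
  move=> x [Ox nD]; apply: sub => /= vx; apply: nD.
  have v0 := vx Ox.
  near \oo => k; exists k => //; split => //=; apply: ltW.
  by near: k; exact: (near_infty_natSinv_lt (PosNum v0)).
rewrite (ge0_negligible_integral (measurableD mO mU) mO mf _ null); last first.
  by move=> x _; rewrite lee_fin.
rewrite setDD.
rewrite (_ : Omega `&` _ = \bigcup_k D k); last first.
  by apply/setIidPr => x [k _ []].
have lD : (lambda%:E * \int[leb]_(x in D k) `|(v x)^-1 * phi x|%:E)%E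
    @[k --> \oo] --> (lambda%:E * \int[leb]_(x in \bigcup_k D k)
      `|(v x)^-1 * phi x|%:E)%E.
  by apply: cvgeZl.
rewrite -(cvg_lim _ lD) //; apply: lime_le; first by apply/cvg_ex; eexists; exact: lD.
by apply: nearW => k; exact: (solution_pairing_abs_trunc p1 oO bO nO l0 sol).
Unshelve. all: by end_near. Qed.

Let integrable_Lp f : in_Lp Omega p f -> leb.-integrable Omega (EFin \o f).
Proof.
move=> [mf fL]; apply/integrableP; split; first exact/measurable_EFinP.
apply: le_lt_trans (integral_le_norm_Lp p1 oO bO mf) _.
by rewrite lte_mul_pinfty // lee_fin powR_ge0.
Qed.

(** Were [lambda] zero, the gradient would vanish; testing against a coordinate
    function, whose derivative is [1], then gives [v] integral zero. *)
Lemma solution_lambda_gt0 (i : 'I_n) : 0 < lambda.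
Proof.
rewrite lt_def l0 andbT; apply/eqP => lam0.
have G0 : norm_Lp Omega p (fun x => enorm (G x)) = 0%E.
  rewrite (solution_norm p1 oO bO sol) lam0 mul0r powR0 //.
  by rewrite invr_eq0 gt_eqF.
have [M M0 xM] : exists2 M, 0 <= M & forall x, Omega x -> `|x ord0 i| <= M.
  have [M [_ hM]] := bO.
  exists (`|M| + 1); first by rewrite addr_ge0.
  move=> x Ox; apply: le_trans (coord_le_norm _ _) _.
  by apply: (hM (`|M| + 1)) => //; rewrite (le_lt_trans (ler_norm M)) // ltrDl.
have [[inv _ _] dens] := Wv.
have mG := W1p_measurable_grad (proj1 Wv).
set volq := V `^ (1 - p^-1).
have volq0 : 0 <= volq by exact: powR_ge0.
have absE : (\int[leb]_(x in Omega) `|v x|%:E = \int[leb]_(x in Omega) (v x)%:E)%E.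
  apply: ae_eq_integral => //.
  - by apply/measurable_EFinP; exact: measurableT_comp.
  - exact/measurable_EFinP.
  - by apply: filterS (solution_gt0 oO sol) => x h1 Ox /=; rewrite gtr0_norm // h1.
have bound e : 0 < e ->
    (\int[leb]_(x in Omega) `|v x|%:E <= (volq * e + volq * (M * e))%:E)%E.
  move=> e0; have [psi tpsi psie] := dens e e0.
  have mgpsi := measurable_grad mO tpsi.
  have [n1 n2] : (norm_Lp Omega p (fun x => v x - psi x)%R <= e%:E)%E /\
      (norm_Lp Omega p (fun x => enorm (G x - grad psi x)) <= e%:E)%E.
    by split; apply: le_trans (ltW psie); [apply: leeDl|apply: leeDr]; exact: norm_Lp_ge0.
  have [[inpsi _ _] _] := W01p_test p0 mO fO tpsi.
  have iv := integrable_Lp inv; have ipsi := integrable_Lp inpsi.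
  have mdiff : measurable_fun Omega (fun x => v x - psi x).
    by apply: measurable_funB => //; exact: measurable_test.
  have mcp : measurable_fun Omega (fun x => (x ord0 i * partial i psi x)%:E).
    apply/measurable_EFinP; apply: measurable_funM; apply: measurable_funTS.
      exact: measurable_rV_coord.
    by apply: continuous_measurable_rV; exact: (test_partial_continuous tpsi).
  have menorm : measurable_fun Omega (fun x => M * enorm (grad psi x)).
    by apply: measurable_funM => //; exact: measurable_enorm.
  have vE x : (v x)%:E = ((v x - psi x)%:E + (psi x)%:E)%E.
    by rewrite -EFinD subrK.
  rewrite absE; under eq_integral do rewrite vE.
  have idiff : leb.-integrable Omega (fun x => (v x - psi x)%:E).
    by have := integrableB mO iv ipsi; apply: eq_integrable => // x _ /=.
  rewrite (integralD mO idiff ipsi).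
  rewrite EFinD; apply: leeD.
    apply: le_trans (lee_abs _) _.
    apply: le_trans (le_abse_integral leb mO _) _; first exact/measurable_EFinP.
    apply: le_trans (integral_le_norm_Lp p1 oO bO mdiff) _.
    by rewrite EFinM lee_wpmul2l.
  rewrite (integral_test_coord i mO tpsi).
  apply: le_trans (lee_abs _) _; rewrite abseN.
  apply: le_trans (le_abse_integral leb mO mcp) _.
  apply: (@le_trans _ _ (\int[leb]_(x in Omega) `|M * enorm (grad psi x)|%:E)%E).
    apply: ge0_le_integral => //.
    - exact: measurableT_comp.
    - by apply/measurable_EFinP; exact: measurableT_comp.
    - move=> x Ox; rewrite lee_fin !normrM (ger0_norm M0) (ger0_norm (enorm_ge0 _)).
      apply: ler_pM => //; first exact: xM.
      by apply: le_trans (coord_le_enorm _ i); rewrite mxE.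
  apply: le_trans (integral_le_norm_Lp p1 oO bO menorm) _.
  rewrite EFinM lee_wpmul2l // (norm_LpZ mO _ p0 (measurable_enorm mgpsi)).
  rewrite EFinM (ger0_norm M0) lee_wpmul2l //.
  apply: le_trans (norm_Lp_enormB mO (ltW p1) mG mgpsi) _.
  by rewrite G0 add0e.
have int0 : (\int[leb]_(x in Omega) `|(v x)%:E| = 0)%E.
  apply/eqP; rewrite eq_le integral_ge0 ?andbT //.
  apply/lee_addgt0Pr => d d0; rewrite add0e.
  pose K := volq + volq * M.
  have K10 : 0 < K + 1 by rewrite ltr_wpDl // addr_ge0 // mulr_ge0.
  have [e e0 eK] : exists2 e, 0 < e & e * (K + 1) = d.
    by exists (d / (K + 1)); rewrite ?divr_gt0 // divfK // gt_eqF.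
  apply: le_trans (bound e e0) _; rewrite lee_fin.
  by rewrite -eK mulrDr mulr1 mulrA -mulrDl [K * e]mulrC -/K lerDl ltW.
have := iffLR (ae_eq_integral_abs leb mO _) int0.
move=> /(_ (iffRL (measurable_EFinP _ _) mv)) v0.
apply: ae_Omega_false.
apply: filterS2 v0 (solution_gt0 oO sol) => x /= h1 h2 Ox.
by have := h2 Ox; have [->] := h1 Ox; rewrite ltxx.
Qed.

End solution_estimates.

(** * Scaling and uniqueness *)

Lemma measurable_scale_rV (R : realType) n (D : set 'rV[R]_n) c
    (G : 'rV[R]_n -> 'rV[R]_n) :
  measurable_fun D G -> measurable_fun D (fun x => c *: G x).
Proof.
move=> mG; have mc : measurable_fun [set: 'rV[R]_n] (fun x => c *: x).
  apply: measurable_fun_rVP => i.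
  rewrite (_ : _ \o _ = fun x => c * rV_coord i x).
    by apply: measurable_funM => //; exact: measurable_rV_coord.
  by apply/funext => x; rewrite /rV_coord /= mxE.
exact: (measurableT_comp mc mG).
Qed.

Section scaling_uniqueness.
Variables (R : realType) (n : nat).
Local Notation E := 'rV[R]_n.
Local Notation leb := (lebesgue_rV R n).
Variables (p : R) (Omega : set E).
Hypotheses (p1 : 1 < p) (oO : open Omega) (bO : bounded_set Omega)
  (nO : Omega !=set0).

Local Notation V := (fine (leb Omega)).

Let p0 : 0 < p. Proof. exact: lt_trans p1. Qed.

Let mO : measurable Omega. Proof. exact: open_measurable_rV. Qed.

Lemma grad_scale c (phi : E -> R) x : test_function Omega phi ->
  grad (fun y => c * phi y) x = c *: grad phi x.
Proof.
by move=> tphi; apply/rowP => i; rewrite !mxE (partial_scale _ _ tphi).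
Qed.

(** Rescaled test functions are test functions; the weak gradient identity is
    that of [v] for the rescaled test function. *)
Lemma W01pZ c v G : 0 < c -> W01p Omega p v G ->
  W01p Omega p (fun x => c * v x) (fun x => c *: G x).
Proof.
move=> c0 [[[mv fv] [mG fG] wG] dens].
have normcG (H : E -> E) : measurable_fun Omega (fun x => enorm (H x)) ->
    norm_Lp Omega p (fun x => enorm (c *: H x)) =
    (c%:E * norm_Lp Omega p (fun x => enorm (H x)))%E.
  move=> mH; rewrite -{2}(gtr0_norm c0) -norm_LpZ //; congr norm_Lp.
  by apply/funext => x; rewrite enormZ gtr0_norm.
split; first split.
- split; first exact: measurable_funM.
  by rewrite norm_LpZ // lte_mul_pinfty.
- split; first exact: measurable_scale_rV.
  by rewrite normcG ?lte_mul_pinfty ?lee_fin ?(ltW c0) //; exact: measurable_enorm.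
- move=> phi tphi i.
  have := wG _ (test_scale (lt0r_neq0 c0) tphi) i.
  rewrite (partial_scale _ _ tphi) => h.
  transitivity (\int[leb]_(x in Omega) (v x * (c * partial i phi x))%:E)%E.
    by apply: eq_integral => x _; rewrite mulrCA mulrA.
  rewrite h; congr (- _)%E; apply: eq_integral => x _.
  by rewrite mxE mulrCA mulrA.
- move=> e e0; have [phi tphi phie] := dens (e / c) (divr_gt0 e0 c0).
  exists (fun x => c * phi x); first exact: (test_scale (lt0r_neq0 c0) tphi).
  have mgphi := measurable_grad mO tphi.
  under eq_fun do rewrite -mulrBr.
  rewrite norm_LpZ //; last first.
    by apply: measurable_funB => //; exact: measurable_test.
  rewrite (_ : (fun x => enorm _) = fun x => enorm (c *: (G x - grad phi x))).
    rewrite normcG ?(gtr0_norm c0); last exact: measurable_enormB.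
    rewrite -ge0_muleDr ?norm_Lp_ge0 //.
    by rewrite -(@lte_pdivlMl _ (c)) // muleC -EFinM in phie *.
  by apply/funext => x; rewrite grad_scale // scalerBr.
Qed.

(** Testing the equation of [v] with [c ^ (p - 1) phi] gives the left-hand side
    for [c v] and [phi] and, up to the factor [c ^ p], its right-hand side. *)
Lemma solvesZ c lambda v G : 0 < c -> solves p Omega lambda v G ->
  solves p Omega (c `^ p * lambda) (fun x => c * v x) (fun x => c *: G x).
Proof.
move=> c0 [Wv vK veq]; have cn0 := lt0r_neq0 c0.
split; first exact: W01pZ.
- move=> K cK KO; rewrite /ess_inf_on.
  rewrite (_ : patch _ _ _ = cst c%:E \* patch (cst +oo%E) K (EFin \o v))%E.
    by rewrite ess_inf_pZl // mule_gt0 // vK.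
  apply/funext => x; rewrite /patch /=; case: ifP => //= _.
  by rewrite gt0_muley ?lte_fin.
- move=> phi Gphi Wphi.
  have [i1 _] := veq _ _ (W01pZ (c := c^-1) ltac:(by rewrite invr_gt0) Wphi).
  have i2 : leb.-integrable Omega (fun x => ((c * v x)^-1 * phi x)%:E).
    apply: eq_integrable i1 => // x _; congr (_%:E).
    by rewrite invfM mulrCA mulrA.
  split=> //.
  have [_ eq2] := veq _ _ (W01pZ (powR_gt0 (p - 1) c0) Wphi).
  transitivity (\int[leb]_(x in Omega) (enorm (G x) `^ (p - 2) *
      dotrv (G x) (c `^ (p - 1) *: Gphi x))%:E)%E.
    apply: eq_integral => x _; congr (_%:E).
    rewrite enormZ powRM ?enorm_ge0 // dotrvZl dotrvZr (gtr0_norm c0).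
    by rewrite -powRB1M ?ltW //; ring.
  rewrite eq2 [c `^ p * lambda]mulrC EFinM -muleA -[in RHS]integralZl //.
  apply: (f_equal (fun z => lambda%:E * z)%E).
  apply: eq_integral => x _; congr (_%:E).
  rewrite -(mulr_powRB1 (ltW c0) p0) invfM.
  by move: ((v x)^-1) => w; field.
Qed.

(** No comparison principle is involved: Hoelder's inequality bounds the
    integrals of [v2 / v1] and [v1 / v2] by the volume, and the sum of a positive
    number and its inverse is at least [2], with equality only at [1]. *)
Lemma solves_uniq lambda v1 G1 v2 G2 : 0 < lambda ->
  solves p Omega lambda v1 G1 -> solves p Omega lambda v2 G2 ->
  {ae leb, forall x, Omega x -> v1 x = v2 x}.
Proof.
move=> l0 s1 s2.
have V0 := vol_gt0 oO bO nO.
have half v w Gv Gw : solves p Omega lambda v Gv -> solves p Omega lambda w Gw ->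
    leb.-integrable Omega (fun x => ((v x)^-1 * w x)%:E) /\
    (\int[leb]_(x in Omega) ((v x)^-1 * w x)%:E <= V%:E)%E.
  move=> sv sw; have [Ww _ _] := sw; have [_ _ /(_ _ _ Ww)[iw _]] := sv.
  split=> //; have := solution_pairing p1 oO bO sv Ww.
  rewrite (solution_norm p1 oO bO sw) -EFinM -powRD; last first.
    by rewrite subrK oner_eq0.
  rewrite subrK powRr1; last by rewrite mulr_ge0 // ltW.
  by rewrite EFinM lee_pmul2l ?lte_fin.
have [i12 le12] := half _ _ _ _ s1 s2.
have [i21 le21] := half _ _ _ _ s2 s1.
have p1' := solution_gt0 oO s1; have p2' := solution_gt0 oO s2.
pose f x := (v1 x)^-1 * v2 x + (v2 x)^-1 * v1 x - 2.
have fO : (leb Omega < +oo)%E by exact: lebesgue_bounded.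
have isum := integrableD mO i12 i21.
have i2 : leb.-integrable Omega (EFin \o cst (2 : R)).
  by apply: measurable_bounded_integrable => //; exact: bounded_cst.
have if2 : leb.-integrable Omega (fun x => (f x)%:E).
  by have := integrableB mO isum i2; apply: eq_integrable.
have intf : (\int[leb]_(x in Omega) (f x)%:E <= 0)%E.
  rewrite (_ : (fun x => (f x)%:E) = fun x =>
     ((((v1 x)^-1 * v2 x)%:E + ((v2 x)^-1 * v1 x)%:E) - 2%:E)%E) //.
  rewrite (integralB mO isum i2) (integralD mO i12 i21).
  rewrite (integral_cst_Omega oO bO 2).
  rewrite leeBlDr // add0e mulr_natl mulr2n EFinD.
  exact: leeD.
have f0 : {ae leb, forall x, Omega x -> 0 <= f x}.
  apply: filterS2 p1' p2' => x h1 h2 Ox; have a0 := h1 Ox; have b0 := h2 Ox.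
  rewrite (_ : f x = (v1 x - v2 x) ^+ 2 / (v1 x * v2 x)).
    by rewrite divr_ge0 ?sqr_ge0 // mulr_ge0 // ltW.
  by rewrite /f; field; rewrite !gt_eqF.
have mf := measurable_int leb if2.
have int0 : (\int[leb]_(x in Omega) `|(f x)%:E| = 0)%E.
  apply/eqP; rewrite eq_le integral_ge0 ?andbT //.
  apply: le_trans intf; rewrite le_eqVlt; apply/orP; left; apply/eqP.
  apply: ae_eq_integral => //; first exact: measurableT_comp.
  by apply: filterS f0 => x h Ox /=; rewrite ger0_norm // h.
have fz := iffLR (ae_eq_integral_abs leb mO mf) int0.
apply: filterS3 fz p1' p2' => x /= h h1 h2 Ox.
have a0 := h1 Ox; have b0 := h2 Ox; have [f0x] := h Ox.
have : (v1 x - v2 x) ^+ 2 = 0.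
  have <- : f x * (v1 x * v2 x) = (v1 x - v2 x) ^+ 2.
    by rewrite /f; field; rewrite !gt_eqF.
  by rewrite f0x mul0r.
by move/eqP; rewrite sqrf_eq0 subr_eq0 => /eqP.
Qed.

End scaling_uniqueness.

(** * Power means for small exponents *)

Section power_quotient.
Variable R : realType.
Implicit Types t r s : R.

(** As [r] decreases to [0] this decreases to [ln t]. *)
Definition powq t r := (t `^ r - 1) / r.

Lemma ln_le_sub1 t : 0 < t -> ln t <= t - 1.
Proof.
by move=> t0; have := expR_ge1Dx (ln t); rewrite lnK ?posrE // -lerBrDl.
Qed.

(** Young's inequality applied to [t ^ r * 1] with exponents [s / r] and
    [s / (s - r)]: the convexity of the power [s / r]. *)
Lemma le_powq t r s : 0 < t -> 0 < r -> r <= s -> powq t r <= powq t s.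
Proof.
move=> t0 r0; rewrite le_eqVlt => /predU1P[->//|rs].
have s0 : 0 < s by exact: lt_trans rs.
have sr0 : 0 < s - r by rewrite subr_gt0.
have := @conjugate_powR R (t `^ r) 1 (s / r) (s / (s - r)) (powR_ge0 _ _) ler01
  (divr_gt0 s0 r0) (divr_gt0 s0 sr0).
rewrite powR1 mulr1 -powRrM [r * _]mulrC divfK ?gt_eqF // => h.
have {h} h : t `^ r <= t `^ s / (s / r) + 1 / (s / (s - r)).
  by apply: h; field; rewrite !gt_eqF.
rewrite /powq ler_pdivrMr // lerBlDr; apply: le_trans h _.
by rewrite le_eqVlt; apply/orP; left; apply/eqP; field; rewrite !gt_eqF.
Qed.

Lemma ln_le_powq t r : 0 < t -> 0 < r -> ln t <= powq t r.
Proof.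
move=> t0 r0; rewrite /powq ler_pdivlMr // mulrC -ln_powR.
by apply: ln_le_sub1; exact: powR_gt0.
Qed.

Lemma powq_le_ln t r : 0 < t -> 0 < r -> powq t r <= ln t * expR (r * ln t).
Proof.
move=> t0 r0; rewrite /powq /powR gt_eqF // ler_pdivrMr //.
have := expR_ge1Dx (- (r * ln t)); rewrite expRN => h.
have e0 := expR_gt0 (r * ln t).
have := ler_wpM2r (ltW e0) h; rewrite mulVf ?gt_eqF //.
by rewrite mulrDl mul1r; lra.
Qed.

(** Both bounds come from [1 + x <= exp x], at [x = r * ln t] and at its
    opposite. *)
Lemma cvg_powq t : 0 < t -> powq t k.+1%:R^-1 @[k --> \oo] --> ln t.
Proof.
move=> t0.
have c : ln t * expR (k.+1%:R^-1 * ln t) @[k --> \oo] --> ln t.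
  rewrite [X in _ --> X](_ : ln t = ln t * expR (0 * ln t)).
    apply: cvgM; first exact: cvg_cst.
    apply: continuous_cvg; first exact: continuous_expR.
    by apply: cvgM; [exact: cvg_harmonic|exact: cvg_cst].
  by rewrite mul0r expR0 mulr1.
apply: (squeeze_cvgr _ (cvg_cst (ln t)) c).
apply: nearW => k; have k0 : 0 < k.+1%:R^-1 :> R by rewrite invr_gt0.
by rewrite ln_le_powq // powq_le_ln.
Qed.

End power_quotient.

Section geometric_mean.
Local Open Scope ereal_scope.
Context d (T : measurableType d) (R : realType).
Variables (mu : {measure set T -> \bar R}) (D : set T) (V : R) (U : T -> R).
Hypotheses (mD : measurable D) (V0 : (0 < V)%R) (DV : mu D = V%:E).
Hypotheses (mU : measurable_fun D U) (U0 : forall x, D x -> (0 < U x)%R).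
Hypothesis iU : mu.-integrable D (EFin \o U).

Let D_lty : mu D < +oo. Proof. by rewrite DV ltry. Qed.

Let i1 (c : R) : mu.-integrable D (EFin \o cst c).
Proof. by apply: measurable_bounded_integrable => //; exact: bounded_cst. Qed.

Lemma integrable_powR r : (0 < r <= 1)%R ->
  mu.-integrable D (EFin \o (fun x => U x `^ r)%R).
Proof.
move=> /andP[r0 r1].
apply: (le_integrable mD _ _ (integrableD mD (i1 1) iU)).
  by apply/measurable_EFinP; exact: (measurableT_comp (measurable_powR r)).
move=> x Dx; rewrite /= lee_fin (ger0_norm (powR_ge0 _ _)) ger0_norm; last first.
  by rewrite addr_ge0 // ltW // U0.
have [U1|U1] := leP 1%R (U x).
  apply: (@le_trans _ _ (U x `^ 1)%R); first exact: ler_powR.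
  by rewrite powRr1 ?lerDr // ltW // U0.
apply: (@le_trans _ _ 1%R); last by rewrite lerDl ltW // U0.
have := @ge0_ler_powR R r (ltW r0) (U x) 1%R.
by rewrite powR1 !nnegrE => h; apply: h => //; apply: ltW => //; exact: U0.
Qed.

(** The root is left out: this is the power [r] of the usual mean of
    exponent [r]. *)
Definition power_mean r : R := (\int[mu]_(x in D) (U x `^ r) / V)%R.

(** The logarithm of the usual mean of exponent [r]. *)
Definition log_mean r : R := (ln (power_mean r) / r)%R.

Let int_cst (c : R) : (\int[mu]_(x in D) c = c * V)%R.
Proof. by rewrite Rintegral_cst // DV. Qed.

Let i_powq r : (0 < r <= 1)%R ->
  mu.-integrable D (EFin \o (fun x => powq (U x) r)).
Proof.
move=> r01; have := integrableZr mD r^-1 (integrableB mD (integrable_powR r01) (i1 1)).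
by apply: eq_integrable.
Qed.

Let int_powq r : (0 < r <= 1)%R ->
  (\int[mu]_(x in D) powq (U x) r = V * ((power_mean r - 1) / r))%R.
Proof.
move=> r01; rewrite /powq RintegralZr //; last first.
  by have := integrableB mD (integrable_powR r01) (i1 1); apply: eq_integrable.
rewrite RintegralB //; [|exact: integrable_powR|exact: i1].
rewrite int_cst mul1r mulrA mulrBr mulr1 /power_mean.
by rewrite mulrCA divff ?mulr1 // gt_eqF.
Qed.

Lemma power_mean_gt0 r : (0 < r <= 1)%R -> (0 < power_mean r)%R.
Proof.
move=> r01; rewrite divr_gt0 // lt_neqAle Rintegral_ge0 ?andbT; last first.
  by move=> x _; exact: powR_ge0.
apply/eqP => /esym int0.
have ir := integrable_powR r01; have mr := measurable_int mu ir.
have : \int[mu]_(x in D) `|(U x `^ r)%:E| = 0.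
  under eq_integral do rewrite gee0_abs ?lee_fin ?powR_ge0 //.
  by rewrite -(fineK (integrable_fin_num mD ir)) -/(Rintegral _ _ _) int0.
move/(iffLR (ae_eq_integral_abs mu mD mr)) => [N [mN N0 sub]].
suff : mu D = 0 by rewrite DV => -[]; apply/eqP; rewrite gt_eqF.
apply/eqP; rewrite eq_le measure_ge0 andbT -N0.
apply: le_measure; rewrite ?inE // => x Dx; apply: sub => /= /(_ Dx) [].
by apply/eqP; rewrite gt_eqF // powR_gt0 // U0.
Qed.

Let log_mean_le_powq r : (0 < r <= 1)%R ->
  (V * log_mean r <= \int[mu]_(x in D) powq (U x) r)%R.
Proof.
move=> r01; have /andP[r0 r1] := r01.
rewrite int_powq // ler_pM2l // ler_pM2r ?invr_gt0 //.
by apply: ln_le_sub1; exact: power_mean_gt0.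
Qed.

Let le_int_powq r s : (0 < r)%R -> (r <= s)%R -> (s <= 1)%R ->
  (\int[mu]_(x in D) powq (U x) r <= \int[mu]_(x in D) powq (U x) s)%R.
Proof.
move=> r0 rs s1; apply: le_Rintegral => //.
- by apply: i_powq; rewrite r0 (le_trans rs).
- by apply: i_powq; rewrite s1 (lt_le_trans r0).
- by move=> x Dx; apply: le_powq => //; exact: U0.
Qed.

(** Jensen's inequality, from the tangent of the logarithm at the mean. *)
Lemma log_mean_ge r : (0 < r <= 1)%R ->
  mu.-integrable D (EFin \o (fun x => ln (U x))) ->
  (\int[mu]_(x in D) ln (U x) <= V * log_mean r)%R.
Proof.
move=> r01 iln; have /andP[r0 r1] := r01.
have A0 := power_mean_gt0 r01; set A := power_mean r in A0.
have iA := integrableZl mD A^-1 (integrable_powR r01).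
have : (\int[mu]_(x in D) (r * ln (U x)) <=
    \int[mu]_(x in D) (A^-1 * U x `^ r + (ln A - 1)))%R.
  apply: le_Rintegral => //.
  - by have := integrableZl mD r iln; apply: eq_integrable.
  - by have := integrableD mD iA (i1 (ln A - 1)); apply: eq_integrable.
  - move=> x Dx; have Ur : (0 < U x `^ r)%R by rewrite powR_gt0 // U0.
    have := @ln_le_sub1 R (A^-1 * U x `^ r)%R.
    rewrite mulr_gt0 ?invr_gt0 // => /(_ isT).
    rewrite lnM ?posrE ?invr_gt0 // lnV ?posrE // ln_powR; lra.
rewrite RintegralZl // RintegralD //; last exact: i1.
rewrite RintegralZl //; last exact: integrable_powR.
rewrite int_cst.
have -> : (\int[mu]_(x in D) U x `^ r = V * A)%R.
  by rewrite /A /power_mean mulrCA divff ?mulr1 // gt_eqF.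
rewrite mulrCA mulVf ?gt_eqF // mulr1 mulrBl mul1r addrCA subrr addr0.
rewrite /log_mean -/A mulrA ler_pdivlMr // [(_ * r)%R]mulrC.
by rewrite [(V * _)%R]mulrC.
Qed.

(** Since [powq] decreases to the logarithm these nonnegative functions increase,
    which is what monotone convergence asks for. *)
Let gap k x := (((U x - 1) - powq (U x) k.+1%:R^-1)%:E).

Let gap_lim x := ((U x - 1) - ln (U x))%:E.

Let kinv k : (0 < (k.+1%:R^-1 : R) <= 1)%R.
Proof. by rewrite invr_gt0 ltr0Sn /= invf_le1 // ler1n. Qed.

Let iU1 : mu.-integrable D (EFin \o (fun x => U x - 1)%R).
Proof. by have := integrableB mD iU (i1 1); apply: eq_integrable. Qed.

Let i_gap k : mu.-integrable D (gap k).
Proof. by have := integrableB mD iU1 (i_powq (kinv k)); apply: eq_integrable. Qed.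

Let cvg_int_gap :
  \int[mu]_(x in D) gap k x @[k --> \oo] --> \int[mu]_(x in D) gap_lim x.
Proof.
have gapE x : D x -> limn (gap^~ x) = gap_lim x.
  move=> Dx; apply/cvg_lim => //; apply: cvg_EFin; first exact: nearW.
  by apply: cvgB; [exact: cvg_cst|exact/cvg_powq/U0].
rewrite (_ : \int[mu]_(x in D) gap_lim x = \int[mu]_(x in D) limn (gap^~ x)).
  apply: cvg_monotone_convergence => //.
  - by move=> k; exact: (measurable_int mu (i_gap k)).
  - move=> k x Dx; rewrite lee_fin subr_ge0.
    have := @le_powq R (U x) k.+1%:R^-1 1 (U0 Dx); have /andP[k0 k1] := kinv k.
    move=> /(_ k0 k1); rewrite [leRHS]/powq divr1 powRr1 //.
    exact/ltW/U0.
  - move=> x Dx j k jk; rewrite lee_fin lerD2l lerN2.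
    have /andP[k0 _] := kinv k.
    by apply: le_powq => //; [exact: U0|rewrite lef_pV2 ?posrE // ler_nat].
by apply: eq_integral => x; rewrite inE => Dx; rewrite gapE.
Qed.

Let int_gap k : \int[mu]_(x in D) gap k x =
  (\int[mu]_(x in D) (U x - 1) -
   \int[mu]_(x in D) powq (U x) k.+1%:R^-1)%:E.
Proof.
rewrite -RintegralB //; last exact: i_powq.
by rewrite /Rintegral fineK //; exact: (integrable_fin_num mD (i_gap k)).
Qed.

(** [ln A <= A - 1] bounds [log_mean] by the mean of [powq], which is monotone
    in the exponent; one good exponent [1 / (k + 1)] is thus enough. *)
Let log_mean_near b :
  ((\int[mu]_(x in D) (U x - 1) - V * b)%:E < \int[mu]_(x in D) gap_lim x) ->
  \forall r \near 0^'+, (log_mean r <= b)%R.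
Proof.
move=> lt_b.
have : \forall k \near \oo,
    (\int[mu]_(x in D) (U x - 1) - V * b)%:E < \int[mu]_(x in D) gap k x.
  have : nbhs (\int[mu]_(x in D) gap_lim x)
      [set y | (\int[mu]_(x in D) (U x - 1) - V * b)%:E < y].
    exact: open_ereal_gt' lt_b.
  by move/cvg_int_gap.
move=> [k _ /(_ k (leqnn k))]; rewrite int_gap lte_fin ltrD2l ltrN2 => kb.
have /andP[k0 k1] := kinv k.
near=> r.
rewrite -(ler_pM2l V0); apply: le_trans (ltW kb).
have r0 : (0 < r)%R by [].
have rk : (r <= k.+1%:R^-1)%R by near: r; exact: nbhs_right_le.
apply: le_trans (log_mean_le_powq _) (le_int_powq r0 rk k1).
by rewrite r0 (le_trans rk).
Unshelve. all: by end_near. Qed.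

(** The power means decrease to the geometric mean as the exponent decreases
    to [0]: below by Jensen, above by [ln A <= A - 1] and monotone convergence of
    the difference quotients. *)
Lemma log_mean_cvg :
  (forall b, \forall r \near 0^'+, (log_mean r <= b)%R) \/
  mu.-integrable D (EFin \o (fun x => ln (U x))) /\
  log_mean r @[r --> 0^'+] --> (\int[mu]_(x in D) ln (U x) / V)%R.
Proof.
have gap0 x : D x -> 0 <= gap_lim x.
  by move=> Dx; rewrite lee_fin subr_ge0; exact/ln_le_sub1/U0.
have mln : measurable_fun D (EFin \o (fun x => ln (U x))).
  by apply/measurable_EFinP; exact: (measurableT_comp (@measurable_ln R)).
have mlim : measurable_fun D gap_lim.
  apply/measurable_EFinP; apply: measurable_funB.
    exact/measurable_EFinP/(measurable_int mu iU1).
  exact/measurable_EFinP.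
have [inf|fin] := eqVneq (\int[mu]_(x in D) gap_lim x) +oo.
  by left=> b; apply: log_mean_near; rewrite inf ltry.
right.
have igap : mu.-integrable D gap_lim.
  apply/integrableP; split=> //.
  under eq_integral => x do rewrite inE => Dx.
  rewrite (_ : \int[mu]_(x in D) _ = \int[mu]_(x in D) gap_lim x).
    by rewrite ltey.
  by apply: eq_integral => x; rewrite inE => Dx; rewrite gee0_abs // gap0.
have iln : mu.-integrable D (EFin \o (fun x => ln (U x))).
  have := integrableB mD iU1 igap; apply: eq_integrable => // x _ /=.
  by congr (_%:E); rewrite opprB addrC subrK.
split=> //; set I := (\int[mu]_(x in D) ln (U x))%R.
apply/cvgrPdist_le => e e0; near=> r.
have r0 : (0 < r)%R by [].
have r1 : (r <= 1)%R by near: r; exact: nbhs_right_le.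
have ge : (I / V <= log_mean r)%R.
  by rewrite ler_pdivrMr // mulrC; apply: log_mean_ge => //; rewrite r0.
rewrite ler0_norm ?subr_le0 // opprB lerBlDl.
near: r; apply: log_mean_near.
have -> : \int[mu]_(x in D) gap_lim x = (\int[mu]_(x in D) (U x - 1) - I)%:E.
  rewrite /I -RintegralB // /Rintegral fineK //.
  exact: (integrable_fin_num mD igap).
rewrite lte_fin ltrD2l ltrN2 mulrDr mulrCA divff ?gt_eqF // mulr1.
by rewrite ltrDl mulr_gt0.
Unshelve. all: by end_near. Qed.

End geometric_mean.

(** * Bounds on the infimum and the limit *)

Section eigenvalue_limit.
Variables (R : realType) (n : nat).
Local Notation E := 'rV[R]_n.
Local Notation leb := (lebesgue_rV R n).
Variables (p : R) (Omega : set E).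
Hypotheses (p1 : 1 < p) (oO : open Omega) (bO : bounded_set Omega)
  (nO : Omega !=set0).

Local Notation V := (fine (leb Omega)).

Let p0 : 0 < p. Proof. exact: lt_trans p1. Qed.

Let mO : measurable Omega. Proof. exact: open_measurable_rV. Qed.

Let fO : (leb Omega < +oo)%E. Proof. exact: lebesgue_bounded. Qed.

Let V0 : 0 < V. Proof. exact: vol_gt0. Qed.

Let LV : leb Omega = V%:E. Proof. exact: volE. Qed.

Variables (lambda : R) (u : E -> R) (G : E -> E).
Hypotheses (l0 : 0 < lambda) (sol : solves p Omega lambda u G).

Let m := lambda * V.

Let m0 : 0 < m. Proof. exact: mulr_gt0. Qed.

Let Wu : W01p Omega p u G. Proof. by case: sol. Qed.

Let mu : measurable_fun Omega u. Proof. exact: W1p_measurable (proj1 Wu). Qed.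

(** Changes [u] on a null set so that powers and logarithms can be handled
    pointwise. *)
Definition pos_repr x := if 0 < u x then u x else 1.

Local Notation U := pos_repr.

Lemma pos_repr_gt0 x : 0 < U x.
Proof. by rewrite /pos_repr; case: ifP. Qed.

Lemma ae_pos_repr : {ae leb, forall x, Omega x -> u x = U x}.
Proof.
by apply: filterS (solution_gt0 oO sol) => x h Ox; rewrite /pos_repr h.
Qed.

Lemma measurable_pos_repr : measurable_fun Omega U.
Proof.
apply: measurable_fun_if => //.
- exact: measurable_fun_ltr.
- by apply: measurable_funS mu => //; apply: subIsetl.
Qed.

Lemma integrable_pos_repr : leb.-integrable Omega (EFin \o U).
Proof.
have iu : leb.-integrable Omega (EFin \o u).
  have [[[_ fu] _ _] _] := Wu.
  apply/integrableP; split; first exact/measurable_EFinP.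
  apply: le_lt_trans (integral_le_norm_Lp p1 oO bO mu) _.
  by rewrite lte_mul_pinfty // lee_fin powR_ge0.
have i1 : leb.-integrable Omega (EFin \o cst (1 : R)).
  by apply: measurable_bounded_integrable => //; exact: bounded_cst.
apply: (le_integrable mO _ _ (integrableD mO i1 (integrable_norm iu))).
  by apply/measurable_EFinP; exact: measurable_pos_repr.
move=> x Ox; rewrite /= lee_fin [leRHS]ger0_norm ?addr_ge0 //.
rewrite /pos_repr; case: ifP => _; first by rewrite lerDr.
by rewrite normr1 lerDl.
Qed.

Local Notation A := (power_mean leb Omega V U).
Local Notation g := (log_mean leb Omega V U).

Let U0 : forall x, Omega x -> 0 < U x.
Proof. by move=> x _; exact: pos_repr_gt0. Qed.

Let A_gt0 r : 0 < r <= 1 -> 0 < A r.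
Proof.
exact: (power_mean_gt0 mO V0 LV measurable_pos_repr U0 integrable_pos_repr).
Qed.

Let lnA r : 0 < r -> ln (A r) = r * g r.
Proof. by move=> r0; rewrite /log_mean mulrCA divff ?mulr1 // gt_eqF. Qed.

Lemma integral_pos_repr r : 0 < r <= 1 ->
  (\int[leb]_(x in Omega) (U x `^ r)%:E = (V * A r)%:E)%E.
Proof.
move=> r01; rewrite /power_mean mulrCA divff ?mulr1 ?gt_eqF //.
rewrite /Rintegral fineK //; apply: (integrable_fin_num mO).
exact: (integrable_powR mO LV measurable_pos_repr U0 integrable_pos_repr r01).
Qed.

Let Lambda q := (lambda_q Omega p q * leb Omega `^ (p / q)%R)%E.

(** The multiple of [u] of unit [L^q] norm competes in the infimum. *)
Lemma Lambda_le q : 0 < q <= 1 -> (Lambda q <= (m * expR (- p * g q))%:E)%E.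
Proof.
move=> q01; have /andP[q0 q1] := q01.
have S0 : 0 < V * A q by rewrite mulr_gt0 // A_gt0.
pose c := (V * A q) `^ (- q^-1).
have c0 : 0 < c by exact: powR_gt0.
have solc := solvesZ p1 oO c0 sol.
have mUq : measurable_fun Omega (fun x => (U x `^ q)%:E).
  apply/measurable_EFinP.
  exact: (measurableT_comp (measurable_powR q) measurable_pos_repr).
have : (lambda_q Omega p q <= (c `^ p * m)%:E)%E.
  apply: ereal_inf_lbound.
  exists (fun x => c * u x), (fun x => c *: G x); split.
  - by case: solc.
  - transitivity (\int[leb]_(x in Omega) ((c `^ q)%:E * (U x `^ q)%:E))%E.
      apply: ae_eq_integral => //.
      + apply: measurable_powR_norm; exact: measurable_funM.
      + exact: measurable_funeM.
      + apply: filterS ae_pos_repr => x h Ox /=; rewrite h //.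
        rewrite normrM (gtr0_norm c0) (gtr0_norm (pos_repr_gt0 x)).
        by rewrite powRM // ltW // pos_repr_gt0.
    rewrite (ge0_integralZl leb mO mUq) ?lee_fin ?powR_ge0 //; last first.
      by move=> x _; rewrite lee_fin powR_ge0.
    rewrite integral_pos_repr // -EFinM /c -powRrM mulNr mulVf ?gt_eqF //.
    by rewrite powR_inv1 ?(ltW S0) // mulVf // gt_eqF.
  - rewrite (norm_Lp_powR _ _ p0) (solution_energy p1 oO bO solc) mulrA //.
move=> le1.
have : (Lambda q <= (c `^ p * m)%:E * (V `^ (p / q))%:E)%E.
  by rewrite /Lambda LV poweR_EFin lee_wpmul2r // lee_fin powR_ge0.
move/le_trans; apply; rewrite -EFinM lee_fin le_eqVlt; apply/orP; left; apply/eqP.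
have Vn0 := lt0r_neq0 V0; have Sn0 := lt0r_neq0 S0.
rewrite /c -powRrM /powR (negPf Vn0) (negPf Sn0) lnM ?posrE ?A_gt0 // lnA //.
rewrite mulrAC -expRD mulrC; congr (_ * expR _).
by field; rewrite gt_eqF.
Qed.

(** Hoelder's inequality with exponents [1 / q] and [1 / (1 - q)] splits
    [|v| ^ q] into the pairing of [v] with [1 / u], which the gradient of [v]
    controls, and a power of [u]. *)
Lemma Lambda_ge q : 0 < q <= 2^-1 ->
  ((m * expR (- p * g (q / (1 - q))))%:E <= Lambda q)%E.
Proof.
move=> /andP[q0 q12].
have q1 : 0 < 1 - q by lra.
set r := q / (1 - q).
have r0 : 0 < r by rewrite divr_gt0.
have r01 : 0 < r <= 1 by rewrite r0 /r ler_pdivrMr // mul1r; lra.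
pose B := m * expR (- p * g r) * expR (- (p / q) * ln V).
suff le : (B%:E <= lambda_q Omega p q)%E.
  have : (B%:E * (V `^ (p / q))%:E <= Lambda q)%E.
    by rewrite /Lambda LV poweR_EFin lee_wpmul2r // lee_fin powR_ge0.
  apply: le_trans; rewrite -EFinM lee_fin le_eqVlt; apply/orP; left; apply/eqP.
  rewrite /B /powR (negPf (lt0r_neq0 V0)) -[RHS]mulrA -expRD.
  rewrite [- (p / q) * _]mulNr addNr.
  by rewrite expR0 mulr1.
apply/ereal_infP => y [v [Gv [Wv int1 ->]]].
have mv := W1p_measurable (proj1 Wv).
have [[_ [_ Lfin] _] _] := Wv.
set L := norm_Lp Omega p _ in Lfin *.
have [l lE] : exists l, L = l%:E.
  by exists (fine L); rewrite fineK // ge0_fin_numE // norm_Lp_ge0.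
have l0' : 0 <= l by rewrite -lee_fin -lE norm_Lp_ge0.
have muinv : measurable_fun Omega (fun x => (u x)^-1).
  exact: (measurableT_comp (@measurable_invr R) mu).
have mf : measurable_fun Omega (fun x => (u x)^-1 * v x) by exact: measurable_funM.
have pair := solution_pairing_abs p1 oO bO nO (ltW l0) sol Wv.
have [_ _ /(_ _ _ Wv)[iuv _]] := sol.
set I := (\int[leb]_(x in Omega) _)%E in pair.
have [X XE] : exists X, I = X%:E.
  exists (fine I); rewrite fineK //.
  exact: (integrable_fin_num mO (integrable_norm iuv)).
have X0 : 0 <= X by rewrite -lee_fin -XE integral_ge0.
move: pair; rewrite XE -/L lE -!EFinM lee_fin -/m => pair.
have hold : 1 <= X `^ q * (V * A r) `^ (1 - q).
  have pq1 : (q^-1)^-1 + ((1 - q)^-1)^-1 = 1 by rewrite !invrK; ring.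
  have mU q' := measurableT_comp (measurable_powR q') measurable_pos_repr.
  have mf' : measurable_fun Omega (fun x => `|(u x)^-1 * v x| `^ q).
    apply: (measurableT_comp (measurable_powR q)); exact: measurableT_comp.
  have e0 : (\int[leb]_(x in Omega)
      (`| `|(u x)^-1 * v x| `^ q * U x `^ q|)%:E = 1)%E.
    rewrite -int1; apply: ae_eq_integral => //.
    - apply/measurable_EFinP; apply: measurableT_comp => //.
      by apply: measurable_funM => //; exact: mU.
    - exact: measurable_powR_norm.
    - apply: filterS ae_pos_repr => x h Ox /=; rewrite h //.
      have Ux := pos_repr_gt0 x.
      rewrite ger0_norm ?mulr_ge0 ?powR_ge0 // -powRM //; last exact: ltW.
      congr ((_ `^ _)%:E); rewrite normrM normfV (gtr0_norm Ux).
      by rewrite mulrAC mulVf ?mul1r // gt_eqF.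
  have e1 : (\int[leb]_(x in Omega)
      (`| `|(u x)^-1 * v x| `^ q| `^ q^-1)%:E = X%:E)%E.
    rewrite -XE; apply: eq_integral => x _; congr (_%:E).
    rewrite (ger0_norm (powR_ge0 _ _)) -powRrM divff ?gt_eqF //.
    by rewrite powRr1.
  have e2 : (\int[leb]_(x in Omega)
      (`|U x `^ q| `^ (1 - q)^-1)%:E = (V * A r)%:E)%E.
    rewrite -(integral_pos_repr r01); apply: eq_integral => x _; congr (_%:E).
    by rewrite (ger0_norm (powR_ge0 _ _)) -powRrM.
  have q0' : 0 < q^-1 by rewrite invr_gt0.
  have q1' : 0 < (1 - q)^-1 by rewrite invr_gt0.
  have N1 : norm_Lp Omega q^-1 (fun x => `|(u x)^-1 * v x| `^ q) = (X `^ q)%:E.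
    by rewrite (norm_LpE _ _ q0') e1 invrK.
  have N2 : norm_Lp Omega (1 - q)^-1 (fun x => U x `^ q) =
      ((V * A r) `^ (1 - q))%:E.
    by rewrite (norm_LpE _ _ q1') e2 invrK.
  rewrite -lee_fin -[leLHS]e0 EFinM -N1 -N2.
  exact: (hoelder_Lp mO q0' q1' pq1 mf' (mU q)).
have Xp : 0 < X.
  rewrite lt_neqAle X0 andbT; apply/eqP => X00; move: hold.
  by rewrite -X00 powR0 ?gt_eqF // mul0r ler10.
have Ar0 := A_gt0 r01.
have lpos : 0 < l.
  rewrite lt_neqAle l0' andbT; apply/eqP => l00; move: pair.
  by rewrite -l00 mulr0 leNgt mulr_gt0.
rewrite poweR_EFin lee_fin /B.
(* everything is positive: compare logarithms *)
have VA0 : 0 < V * A r by exact: mulr_gt0.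
have XAq : 0 < X `^ q * (V * A r) `^ (1 - q).
  by apply: mulr_gt0; exact: powR_gt0.
have h1 : 0 <= q * ln X + (1 - q) * (ln V + r * g r).
  move: hold; rewrite -(ler_ln (x := 1)) ?posrE // ln1.
  by rewrite lnM ?posrE ?(powR_gt0 _ Xp) ?(powR_gt0 _ VA0) // !ln_powR lnM ?posrE // lnA.
have := pair; rewrite -ler_ln ?posrE ?mulr_gt0 ?powR_gt0 //.
rewrite !lnM ?posrE ?powR_gt0 // ln_powR.
have lnl : ln lambda = ln m - ln V by rewrite /m lnM ?posrE // addrK.
rewrite lnl.
move=> h2.
rewrite -ler_ln ?posrE ?mulr_gt0 ?expR_gt0 ?powR_gt0 //.
rewrite !lnM ?posrE ?mulr_gt0 ?expR_gt0 // !expRK ln_powR.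
have {}h2 : p * ln X <= p * ln l + p * ln V - ln m.
  have : p * (ln m - ln V + ln X) <= p * ((1 - p^-1) * ln m + ln l).
    by rewrite ler_pM2l.
  rewrite (_ : p * ((1 - p^-1) * ln m + ln l) = p * ln m - ln m + p * ln l).
    lra.
  by field; rewrite gt_eqF.
have {}h1 : 0 <= p * ln X + p * g r + (p / q - p) * ln V.
  have : 0 <= p / q * (q * ln X + (1 - q) * (ln V + r * g r)).
    by rewrite mulr_ge0 // divr_ge0 // ltW.
  rewrite (_ : p / q * _ = p * ln X + p * g r + (p / q - p) * ln V) //.
  by rewrite /r; field; rewrite !gt_eqF.
move: h1 h2; rewrite mulrBl !mulNr lnl subrK.
move: (p * ln X) (p * g r) (p / q * ln V) (p * ln V) (p * ln l) => a b c d e.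
lra.
Qed.

End eigenvalue_limit.

Lemma cvg_conj_exponent (R : realType) :
  q / (1 - q) @[q --> (0 : R)^'+] --> (0 : R)^'+.
Proof.
move=> P [e /= e0 eP].
suff : \forall q \near (0 : R)^'+, P (q / (1 - q)) by [].
near=> q.
have q0 : 0 < q by [].
have q12 : q <= 2^-1 by near: q; apply: nbhs_right_le; rewrite invr_gt0.
have qe : q < e / 2 by near: q; apply: nbhs_right_lt; rewrite divr_gt0.
have q1 : 0 < 1 - q by lra.
have r0 : 0 < q / (1 - q) by rewrite divr_gt0.
apply: eP => //=; rewrite sub0r normrN gtr0_norm // ltr_pdivrMr //; nra.
Unshelve. all: by end_near. Qed.

Section limit.
Variables (R : realType) (n : nat).
Local Notation E := 'rV[R]_n.
Local Notation leb := (lebesgue_rV R n).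
Variables (p : R) (Omega : set E).
Hypotheses (p1 : 1 < p) (oO : open Omega) (bO : bounded_set Omega)
  (nO : Omega !=set0).
Local Notation V := (fine (leb Omega)).
Variables (lambda : R) (u : E -> R) (G : E -> E).
Hypotheses (l0 : 0 < lambda) (sol : solves p Omega lambda u G).

Let p0 : 0 < p. Proof. exact: lt_trans p1. Qed.
Let mO : measurable Omega. Proof. exact: open_measurable_rV. Qed.
Let V0 : 0 < V. Proof. exact: vol_gt0. Qed.
Let LV : leb Omega = V%:E. Proof. exact: volE. Qed.
Let m0 : 0 < lambda * V. Proof. exact: mulr_gt0. Qed.

Local Notation U := (pos_repr u).
Local Notation g := (log_mean leb Omega V U).

(** The two bounds have the same limit, infinite if [ln u] is not
    integrable. *)
Lemma mu_Omega_log :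
  mu_Omega Omega p = +oo%E \/
  leb.-integrable Omega (EFin \o (fun x => ln (U x))) /\
  mu_Omega Omega p =
    (lambda * V * expR (- p * (\int[leb]_(x in Omega) ln (U x) / V)))%:E.
Proof.
have U0 x : Omega x -> 0 < U x by move=> _; exact: pos_repr_gt0.
have mU := measurable_pos_repr oO sol.
have iU := integrable_pos_repr p1 oO bO sol.
have ge := Lambda_ge p1 oO bO nO l0 sol.
have le := Lambda_le p1 oO bO nO sol.
case: (log_mean_cvg mO V0 LV mU U0 iU) => [ginf|[iln gL]].
- left; apply/cvg_lim => //; apply/cvgeyPge => B.
  (* b solves m * exp (- p * b) = max B 1 *)
  pose b := - ln (Num.max B 1 / (lambda * V)) / p.
  have B1 : 0 < Num.max B 1 by rewrite lt_max ltr01 orbT.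
  have := @cvg_conj_exponent R _ (ginf b); rewrite near_simpl => gb.
  near=> q; apply: le_trans (ge q _); last first.
    apply/andP; split=> //.
    by near: q; apply: nbhs_right_le; rewrite invr_gt0.
  rewrite lee_fin.
  apply: (@le_trans _ _ (lambda * V * expR (- p * b))); last first.
    by rewrite ler_pM2l // ler_expR !mulNr lerN2 ler_pM2l //; near: q.
  have -> : - p * b = ln (Num.max B 1 / (lambda * V)).
    by rewrite /b mulNr [p * _]mulrC divfK ?gt_eqF // opprK.
  rewrite lnK ?posrE ?divr_gt0 // mulrCA divff ?gt_eqF // mulr1.
  by rewrite le_max lexx.
- right; split=> //; set L := _ / V in gL *.
  have expL : (lambda * V * expR (- p * g r))%:E @[r --> 0^'+] -->
      (lambda * V * expR (- p * L))%:E.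
    apply: cvg_EFin; first exact: nearW.
    apply: cvgM; first exact: cvg_cst.
    apply: continuous_cvg; first exact: continuous_expR.
    by apply: cvgM; [exact: cvg_cst|exact: gL].
  have expL' : (lambda * V * expR (- p * g (q / (1 - q))))%:E
      @[q --> 0^'+] --> (lambda * V * expR (- p * L))%:E.
    exact: (cvg_comp _ _ (@cvg_conj_exponent R) expL).
  apply/cvg_lim => //; apply: (squeeze_cvge _ expL' expL).
  near=> q; apply/andP; split.
    apply: ge; apply/andP; split=> //.
    by near: q; apply: nbhs_right_le; rewrite invr_gt0.
  apply: le; apply/andP; split=> //.
  by near: q; exact: nbhs_right_le.
Unshelve. all: by end_near. Qed.

End limit.

Theorem mainTheorem8 (R : realType) (N : nat) (hN : (2 <= N)%N)
    (p : R) (hp : 1 < p) (Omega : set 'rV[R]_N)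
    (hdom : is_domain Omega) (hbdd : bounded_set Omega)
    (hsmooth : smooth_boundary Omega)
    (u : 'rV[R]_N -> R)
    (hu : weak_solution Omega p
            (fine (mu_Omega Omega p) / fine (lebesgue_rV R N Omega)) u)
    (lambda : R) (hlambda : 0 < lambda) :
  let vol := fine (lebesgue_rV R N Omega) in
  let mu := fine (mu_Omega Omega p) in
  let u_lambda := fun x => (lambda * vol / mu) `^ p^-1 * u x in
  [/\ weak_solution Omega p lambda u_lambda,
      (forall v, weak_solution Omega p lambda v ->
         {ae lebesgue_rV R N, forall x, Omega x -> v x = u_lambda x})
    & (\int[lebesgue_rV R N]_(x in Omega) (ln (u_lambda x))%:E =
       (vol / p * ln (lambda * vol / mu))%:E)%E].
Proof.
move=> vol mu u_lambda.
have [oO _ nO] := hdom.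
have mO : measurable Omega := open_measurable_rV oO.
have p0 : 0 < p := lt_trans ltr01 hp.
have V0 : 0 < vol := vol_gt0 oO hbdd nO.
have [G sol] := iffLR (weak_solutionP _ _ _ _) hu.
rewrite -/mu -/vol in sol.
(* mu is the energy of u *)
have m_ge0 : 0 <= mu.
  rewrite -[mu](divfK (lt0r_neq0 V0)) -lee_fin.
  rewrite -(solution_energy hp oO hbdd sol).
  by apply: integral_ge0 => x _; rewrite lee_fin powR_ge0.
have l0 : 0 < mu / vol.
  apply: (solution_lambda_gt0 hp oO hbdd nO _ sol (Ordinal (ltnW hN))).
  by rewrite divr_ge0 // ltW.
have m0 : 0 < mu by rewrite -[mu](divfK (lt0r_neq0 V0)) mulr_gt0.
set c := (lambda * vol / mu) `^ p^-1 in u_lambda *.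
have t0 : 0 < lambda * vol / mu by rewrite divr_gt0 // mulr_gt0.
have c0 : 0 < c by exact: powR_gt0.
have solc : solves p Omega lambda u_lambda (fun x => c *: G x).
  have := solvesZ hp oO c0 sol.
  rewrite /c -powRrM mulVf ?gt_eqF // powRr1 ?(ltW t0) //.
  by rewrite (_ : _ / mu * (mu / vol) = lambda) //; field; rewrite !gt_eqF.
split.
- by apply/weak_solutionP; eexists; exact: solc.
- move=> v /weak_solutionP[Gv solv].
  exact: (solves_uniq hp oO hbdd nO hlambda solv solc).
have [iln intln] : (lebesgue_rV R N).-integrable Omega
      (EFin \o (fun x => ln (pos_repr u x))) /\
    (\int[lebesgue_rV R N]_(x in Omega) (ln (pos_repr u x))%:E = 0)%E.
  case: (mu_Omega_log hp oO hbdd nO l0 sol) => [muoo|[iln muE]].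
    (* the real part of +oo is 0 *)
    by move: m0; rewrite /mu muoo ltxx.
  (* mu = mu * exp (- p * L), so the mean L of ln u is 0 *)
  split=> //; have := congr1 fine muE; rewrite -/mu /= -/vol divfK ?gt_eqF //.
  move=> /eqP; rewrite -{1}[mu]mulr1 (inj_eq (mulfI (lt0r_neq0 m0))).
  rewrite -{1}expR0 (inj_eq (@expR_inj _)) eq_sym !mulf_eq0 oppr_eq0.
  rewrite invr_eq0 (negPf (lt0r_neq0 p0)) (negPf (lt0r_neq0 V0)) orbF /=.
  move=> /eqP int0.
  by rewrite -(fineK (integrable_fin_num mO iln)); congr (_%:E); exact: int0.
have mul : measurable_fun Omega u_lambda.
  have [[[[mv _] _ _] _] _ _] := solc; exact: mv.
have lnfin : (lebesgue_rV R N Omega < +oo)%E by exact: lebesgue_bounded.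
have icst : (lebesgue_rV R N).-integrable Omega (fun _ => (ln c)%:E).
  by apply: measurable_bounded_integrable => //; exact: bounded_cst.
transitivity (\int[lebesgue_rV R N]_(x in Omega)
    ((ln c)%:E + (ln (pos_repr u x))%:E))%E.
  apply: ae_eq_integral => //.
  - apply/measurable_EFinP.
    exact: (measurableT_comp (@measurable_ln R) mul).
  - exact: (measurable_int _ (integrableD mO icst iln)).
  - apply: filterS (ae_pos_repr oO sol) => x h Ox /=.
    by rewrite /u_lambda h // lnM ?posrE // pos_repr_gt0.
rewrite (integralD mO icst iln) intln adde0 integral_cst_Omega // /c ln_powR; congr (_%:E).
by rewrite -/vol; ring.
Qed.
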